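(* For every irrational $\alpha$ with unbounded partial quotients, there exist real measurable functions $\phi$ on $\mathbb T$ for which the associated cylinder flow $T_\phi$ is ergodic and has an uncountable group of eigenvalues.
   Context: $\mathbb T=\mathbb R/\mathbb Z$, $T$ is the translation by $\alpha$ on $\mathbb T$. The cylinder flow is the transformation of $\mathbb T\times\mathbb R$ (with the infinite product Lebesgue measure) defined by $T_\phi(x,y)=(Tx,\,y+\phi(x))$. Its group of eigenvalues $e(T_\phi)$ is the group of $t\in\mathbb T$ for which there exists a measurable function $F\in L^\infty(\mathbb T\times\mathbb R)$, not almost everywhere zero, with $F\circ T_\phi=e^{2i\pi t}F$ almost everywhere. *)

(* Defs.v *)
From HB Require Import structures.
From mathcomp Require Import all_boot all_order all_algebra.
From mathcomp Require Import archimedean ring_quotient complex.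
From mathcomp Require Import all_classical all_reals all_analysis.
From mathcomp Require Import ess_sup_inf.

Set Implicit Arguments.
Unset Strict Implicit.
Unset Printing Implicit Defensive.

Import Order.TTheory GRing.Theory Num.Theory.
Import numFieldNormedType.Exports.
Import Quotient.Exports.

Local Open Scope classical_set_scope.
Local Open Scope ring_scope.
Local Open Scope complex_scope.
Local Open Scope quotient_scope.

(** The subgroup Z of R ([Num.int_num_subdef] is the predicate behind
    [Num.int]), and the circle R/Z as a quotient of additive groups. *)
Definition integers (R : realType) : zmodClosed R :=
  GRing.ZmodClosed.clone R (@Num.int_num_subdef R) _.

Definition circle (R : realType) : Type := Quotient.quot (integers R).

HB.instance Definition _ (R : realType) := GRing.Zmodule.on (circle R).

Definition proj_circle {R : realType} (x : R) : circle R := \pi_(circle R) x.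

Definition repr_circle {R : realType} (t : circle R) : R := repr t.

Lemma repr_circleK (R : realType) :
  cancel (@repr_circle R) (@proj_circle R).
Proof. exact: reprK. Qed.

Lemma proj_circle_is_zmod_morphism (R : realType) :
  zmod_morphism (@proj_circle R).
Proof. exact: raddfB. Qed.

HB.instance Definition _ (R : realType) :=
  GRing.isZmodMorphism.Build R (circle R) proj_circle
    (@proj_circle_is_zmod_morphism R).

Lemma eq_proj_circle (R : realType) (x y : R) :
  proj_circle x = proj_circle y <-> x - y \is a Num.int.
Proof.
rewrite (_ : (x - y \is a Num.int) = (proj_circle x == proj_circle y)).
  by split=> [->|/eqP].
exact: (Quotient.idealrBE (integers R) x y).
Qed.

HB.instance Definition _ (R : realType) := isPointed.Build (circle R) 0.

(** Quotient sigma-algebra: a set is measurable when its preimage in R is. *)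
Definition circle_measurable (R : realType) : set (set (circle R)) :=
  [set A | measurable (@proj_circle R @^-1` A)].

Lemma circle_measurable0 (R : realType) : @circle_measurable R set0.
Proof. by rewrite /circle_measurable /= preimage_set0. Qed.

Lemma circle_measurableC (R : realType) (A : set (circle R)) :
  circle_measurable A -> circle_measurable (~` A).
Proof. by rewrite /circle_measurable /= preimage_setC => /measurableC. Qed.

Lemma circle_measurable_bigcup (R : realType) (F : (set (circle R))^nat) :
  (forall i, circle_measurable (F i)) -> circle_measurable (\bigcup_i F i).
Proof.
move=> mF; rewrite /circle_measurable /= preimage_bigcup.
by apply: bigcupT_measurable => i; exact: mF.
Qed.

Fact circle_display : measure_display. Proof. by []. Qed.

HB.instance Definition _ (R : realType) :=
  @isMeasurable.Build circle_display (circle R) (@circle_measurable R)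
    (@circle_measurable0 R) (@circle_measurableC R)
    (@circle_measurable_bigcup R).

Lemma measurable_proj_circle (R : realType) :
  measurable_fun setT (@proj_circle R : measurableTypeR R -> circle R).
Proof. by move=> _ A mA; rewrite setTI. Qed.

(** Lebesgue (Haar probability) measure on R/Z: the image of Lebesgue measure
    on the fundamental domain [0, 1[. *)
Definition circle_measure {R : realType} : set (circle R) -> \bar R :=
  pushforward
    (mrestr (@lebesgue_measure R) (measurable_itv `[0, 1[))
    (@proj_circle R).

Section circle_measure.
Context {R : realType}.
Local Open Scope ereal_scope.

Let unit_measure : {measure set (measurableTypeR R) -> \bar R} :=
  mrestr lebesgue_measure (measurable_itv `[0%R, 1%R[).

Let circle_measure0 : @circle_measure R set0 = 0.
Proof. by rewrite /circle_measure /pushforward preimage_set0 (measure0 unit_measure). Qed.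

Let circle_measure_ge0 (A : set (circle R)) : 0 <= circle_measure A.
Proof. exact: (measure_ge0 unit_measure). Qed.

Let circle_measure_sigma_additive : semi_sigma_additive (@circle_measure R).
Proof.
move=> F mF tF mUF; rewrite /circle_measure /pushforward preimage_bigcup.
apply: (measure_semi_sigma_additive (s := unit_measure)).
- by move=> n; exact: (mF n).
- apply/trivIsetP => /= i j _ _ ij; rewrite -preimage_setI.
  by move/trivIsetP : tF => /(_ _ _ _ _ ij) ->//; rewrite preimage_set0.
- by rewrite -preimage_bigcup.
Qed.

HB.instance Definition _ := isMeasure.Build _ _ _ (@circle_measure R)
  circle_measure0 circle_measure_ge0 circle_measure_sigma_additive.

Let circle_measureT : @circle_measure R setT = 1.
Proof.
rewrite /circle_measure /pushforward preimage_setT /mrestr setTI.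
by rewrite lebesgue_measure_itv /= lte_fin ltr01 oppr0 adde0.
Qed.

HB.instance Definition _ := Measure_isProbability.Build _ _ _
  (@circle_measure R) circle_measureT.

End circle_measure.

(** The character t |-> e^{2 i pi t} of R/Z; it is evaluated at a
    representative, which is harmless by [circle_exp_proj]. *)
Definition circle_exp {R : realType} (t : circle R) : R[i] :=
  let x := 2 * pi * repr_circle t in cos x +i* sin x.

Lemma circle_exp_proj (R : realType) (x : R) :
  circle_exp (proj_circle x) = cos (2 * pi * x) +i* sin (2 * pi * x).
Proof.
have per (f : R -> R) : periodic f (pi *+ 2) -> forall (k : int) y,
    f (2 * pi * (y + k%:~R)) = f (2 * pi * y).
  move=> pf; suff nat_case n y : f (2 * pi * (y + n%:R)) = f (2 * pi * y).
    case=> n y; first exact: nat_case.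
    by rewrite -(nat_case n.+1 (y + _)) NegzE mulrNz -addrA addNr addr0.
  rewrite -(periodicn pf n (2 * pi * y)) mulrDr.
  by congr (f (_ + _)); rewrite mulr_natr mulr_natl.
have /eq_proj_circle/intrP[k] :
    proj_circle (repr_circle (proj_circle x)) = proj_circle x.
  by rewrite repr_circleK.
move=> /eqP; rewrite subr_eq addrC => /eqP xk.
by rewrite /circle_exp xk !per //; [exact: sinD2pi|exact: cosD2pi].
Qed.

Definition circle_translation {R : realType} (alpha : R) (x : circle R) :
  circle R := x + proj_circle alpha.

Definition cylinder_measure (R : realType) :
    {measure set (circle R * measurableTypeR R) -> \bar R} :=
  (@circle_measure R \x @lebesgue_measure R)%E.

Definition cylinder_flow {R : realType} (alpha : R) (phi : circle R -> R)
    (z : circle R * measurableTypeR R) : circle R * measurableTypeR R :=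
  (circle_translation alpha z.1, z.2 + phi z.1).

Definition ergodic d (X : measurableType d) (R : realType)
    (mu : {measure set X -> \bar R}) (S : X -> X) : Prop :=
  forall A : set X, measurable A ->
    mu.-negligible ((S @^-1` A) `+` A) -> mu A = 0%E \/ mu (~` A) = 0%E.

(** Complex-valued L^oo: a function into R[i] is measurable when its real and
    imaginary parts are. *)
Definition Linfty d (X : measurableType d) (R : realType)
    (mu : {measure set X -> \bar R}) (F : X -> R[i]) : Prop :=
  [/\ measurable_fun setT (fun z => complex.Re (F z)),
      measurable_fun setT (fun z => complex.Im (F z)) &
      (ess_sup mu (fun z => (Normc.normc (F z))%:E) < +oo)%E].

Definition eigenvalues d (X : measurableType d) (R : realType)
    (mu : {measure set X -> \bar R}) (S : X -> X) : set (circle R) :=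
  [set t | exists F : X -> R[i],
    [/\ Linfty mu F,
        ~ (\forall z \ae mu, F z = 0) &
        \forall z \ae mu, F (S z) = circle_exp t * F z]].

(** Continued fraction expansion [a_0; a_1, a_2, ...] of an irrational x:
    x_0 = x, a_n = floor x_n and x_(n+1) = 1 / (x_n - a_n). *)
Definition complete_quotient {R : realType} (x : R) (n : nat) : R :=
  iter n (fun y => (y - (Num.floor y)%:~R)^-1) x.

Definition partial_quotient {R : realType} (x : R) (n : nat) : int :=
  Num.floor (complete_quotient x n).

Definition unbounded_partial_quotients {R : realType} (x : R) : Prop :=
  forall M : int, exists n : nat, M < partial_quotient x n.+1.

(* Main.v *)
Require Import Defs.
From mathcomp Require Import all_boot all_order all_algebra.
From mathcomp Require Import archimedean complex.
From mathcomp Require Import all_classical all_reals all_analysis.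
From mathcomp Require Import measurable_realfun ess_sup_inf.
From mathcomp Require Import ring lra zify.

Set Implicit Arguments.
Unset Strict Implicit.
Unset Printing Implicit Defensive.

Import Order.TTheory GRing.Theory Num.Theory.
Import numFieldNormedType.Exports.

Local Open Scope classical_set_scope.
Local Open Scope ring_scope.

(** Write ||t|| for the distance from t to the integers and {t} for the
    fractional part.  The cocycle is a sum of coboundaries
    phi = sum_k (G_k o T - G_k) of sawtooth functions G_k(x) = K_k {l_k x}.  The
    amplitudes K_k form a fast increasing divisibility chain, and l_k is an
    integer such that K_k ||l_k alpha|| is tiny.  Then G_k o T - G_k is a tiny
    constant, except on the small set where {l_k x} wraps around; so the sum
    converges almost everywhere.

    Ergodicity.  Unbounded partial quotients give q with q ||q alpha||
    arbitrarily small, hence ([approximation_step], [frequency_data_exists])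
    return times n_k and multiples l_k of n_k such that the shift of G_k under
    T^(n_k) is close to any prescribed real number e_k, while T^(n_k) is close
    to the identity and barely changes the other sawtooth functions.  So the
    Birkhoff sum of phi over n_k steps is close to e_k off a small set
    ([birkhoff_drift], [exceptional_measure]).  Letting e_k run through every
    rational infinitely often makes every invariant measure dominated by
    Lebesgue measure also invariant under the vertical translations by rationals.
    Such a measure is a product of some kappa with Lebesgue measure; its
    invariance under the flow then makes kappa rotation invariant, hence a
    multiple of Lebesgue measure ([rigid_measure_unique]).  For the restriction
    of Lebesgue measure to an invariant set A this gives a measure proportional
    to Lebesgue measure and null on the complement of A, so that A is null or
    conull ([rigid_ergodic]).  All this is done on the cover R x R,
    where T^(n_k) is an honest small translation in the first coordinate.

    Eigenvalues.  A sequence b of bits gives s = sum_k b_k / K_(k+1), for which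
    K_k s = m_k + d_k with m_k an integer and d_k summable.  Hence
    u(x) = sum_k d_k {l_k x} converges, and since m_k {l_k x} changes by the
    constant m_k l_k alpha modulo 1, s phi = u o T - u + tau modulo 1 with
    tau = sum_k m_k l_k alpha ([transfer_equation]).  So
    exp(2 i pi (s y - u(x))) is an eigenfunction with eigenvalue tau.  If two
    sequences gave the same tau, the difference of their phases would be an
    invariant function modulo 1 with nonconstant linear dependence on y; the
    set where its fractional part is below 1/2 would be invariant and a vertical
    translation would exchange it with its complement, against ergodicity
    ([ergodic_angle_inj]).  The eigenvalues are therefore as many as the
    sequences of bits. *)

(** * Rational approximation from unbounded partial quotients *)

Lemma complete_quotientS (R : realType) (x : R) n :
  complete_quotient x n.+1 =
  (complete_quotient x n - (partial_quotient x n)%:~R)^-1.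
Proof. by []. Qed.

(** Two consecutive convergents p/q and p'/q', carried along the recursion of
    complete quotients: the first identity says that the homography which they
    define maps x_n to alpha, the second that it is unimodular.  At n = 0 the convergent p/q is 1/0, whence the disjunction. *)
Lemma convergent_exists (R : realType) (alpha : R) n : irrational alpha ->
  exists p q p' q' : int,
  let x := complete_quotient alpha n in
  [/\ x * (q%:~R * alpha - p%:~R) = - (q'%:~R * alpha - p'%:~R),
      `|q * p' - q' * p| = 1,
      (n = 0 /\ q = 0 /\ q' = 1) \/ ((1 <= q) /\ (0 <= q') /\ 1 < x) &
      x != (partial_quotient alpha n)%:~R].
Proof.
move=> irr.
have irr_lin (a b : int) : a != 0 -> a%:~R * alpha != b%:~R.
  move=> a0; apply/eqP => ab; apply: irr; exists (b%:Q / a%:Q) => //.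
  by rewrite fmorph_div /= !ratr_int -ab mulrC mulKf// intr_eq0.
have fl (p q p' q' : int) (x : R) :
    x * (q%:~R * alpha - p%:~R) = - (q'%:~R * alpha - p'%:~R) ->
    (q = 0 /\ q' = 1) \/ ((1 <= q) /\ (0 <= q') /\ 1 < x) ->
    x != (Num.floor x)%:~R.
  move=> xE h; apply/eqP; move: (Num.floor x) => a xa.
  have aq : a * q + q' != 0.
    case: h => [[-> ->]|[q1 [q'0 x1]]]; first by rewrite mulr0 add0r.
    move: x1; rewrite xa (ltr_int R 1 a) => a1; apply: lt0r_neq0.
    by rewrite ltr_wpDr// mulr_gt0//; lia.
  have /negP := irr_lin (a * q + q') (a * p + p') aq; apply; apply/eqP.
  by move: xE; rewrite xa !rmorphD !rmorphM/=; lra.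
elim: n => [|n [p [q [p' [q' [IH1 IH2 IH3 IH4]]]]]].
  exists 1, 0, 0, 1; cbv zeta; have E : alpha * (0%:~R * alpha - 1%:~R) = - (1%:~R * alpha - 0%:~R).
    by rewrite !mulr0z !mulr1z; lra.
  split => //; first by left.
  by apply: (fl _ _ _ _ _ E); left.
set x := complete_quotient alpha n in IH1 IH3 IH4.
set a := partial_quotient alpha n in IH4.
set x' := complete_quotient alpha n.+1.
have x'E : x' = (x - a%:~R)^-1 by rewrite /x' complete_quotientS.
have xa0 : 0 < x - a%:~R.
  by rewrite lt_neqAle eq_sym subr_eq0 IH4 subr_ge0 /a /partial_quotient floor_le.
have x'1 : 1 < x'.
  rewrite x'E invf_gt1// ltrBlDr -[1 in ltRHS](_ : 1%:~R = 1 :> R)//.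
  by rewrite -intrD addrC floorD1_gt.
have E : x' * ((a * q + q')%:~R * alpha - (a * p + p')%:~R) =
         - (q%:~R * alpha - p%:~R).
  rewrite x'E; apply: (mulfI (lt0r_neq0 xa0)); rewrite mulrA divff ?lt0r_neq0//.
  by rewrite !rmorphD !rmorphM/=; lra.
have Q1 : 1 <= a * q + q' /\ 0 <= q.
  case: IH3 => [[_ [-> ->]]|[q1 [q'0 x1]]]; first by rewrite mulr0.
  have a1 : 1 <= a by rewrite /a /partial_quotient floor_ge_int ltW.
  by split; nia.
exists (a * p + p'), (a * q + q'), p, q; split => //.
- by rewrite -IH2 -normrN; congr `|_|; ring.
- by right; case: Q1.
- by apply: (fl _ _ _ _ _ E); right; case: Q1.
Qed.

(** For consecutive convergents, |q alpha - p| (q x_n + q') = 1, so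
    q |q alpha - p| is at most the inverse of the complete quotient x_n, which is
    small as soon as the partial quotient is large. *)
Lemma good_approximation (R : realType) (alpha : R) : irrational alpha ->
  unbounded_partial_quotients alpha -> forall e : R, 0 < e ->
  exists (q : nat) (p : int), let d := q%:R * alpha - p%:~R in
    [/\ (0 < q)%N, d != 0 & q%:R * `|d| < e].
Proof.
move=> irr unb e e0.
have [n an] := unb (Num.bound e^-1).
have [p [q [p' [q' [E D]]]]] := convergent_exists n.+1 irr.
set x := complete_quotient alpha n.+1 in E *.
case=> [[]//|[q1 [q'0 x1]] _].
have xe : e^-1 < x.
  rewrite (lt_le_trans _ (floor_le x))//.
  apply: lt_trans (archi_boundP _) _; first by rewrite invr_ge0 ltW.
  by rewrite -[ltLHS]/(((Num.bound e^-1) : int)%:~R : R) ltr_int.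
set d := q%:~R * alpha - p%:~R in E.
have qx : 0 < q%:~R * x + q'%:~R :> R.
  by rewrite ltr_wpDr ?ler0z// mulr_gt0 ?ltr0z//; lra.
have dE : `|d| * (q%:~R * x + q'%:~R) = 1.
  rewrite -[X in _ * X]gtr0_norm// -normrM.
  have -> : d * (q%:~R * x + q'%:~R) = (q' * p' *+ 0 + (q * p' - q' * p))%:~R.
    move: E; rewrite mulr0n add0r rmorphB !rmorphM /= /d => E.
    have -> : (q%:~R * alpha - p%:~R) * (q%:~R * x + q'%:~R) =
     q%:~R * (x * (q%:~R * alpha - p%:~R)) + q'%:~R * (q%:~R * alpha - p%:~R) by ring.
    by rewrite E; ring.
  by rewrite mulr0n add0r -intr_norm D.
have d0 : d != 0 by apply: contra_eq_neq dE => ->; rewrite normr0 mul0r eq_sym oner_eq0.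
exists `|q|%N, p.
have -> : (`|q|%N)%:R = q%:~R :> R.
  by rewrite natr_absz ger0_norm//; lia.
split => //; first by lia.
have q'0R : 0 <= q'%:~R :> R by rewrite ler0z.
have q0R : 0 < q%:~R :> R by rewrite ltr0z; lia.
rewrite -ltf_pV2 ?posrE ?mulr_gt0 ?normr_gt0//.
apply: (lt_le_trans xe).
have dq' : 0 <= `|d| * q'%:~R by rewrite mulr_ge0.
have qd : 0 < q%:~R * `|d| by rewrite mulr_gt0 ?normr_gt0.
suff : x * (q%:~R * `|d|) <= 1 by rewrite -ler_pdivlMr// mul1r.
move: dE; lra.
Qed.

(** * Frequencies and return times *)

(** Consecutive ratios are the integers 4^(k+1), so that a number with digits
    0 and 1 in this mixed base is summably close to its truncations even after
    multiplication by the amplitudes; the quadratic exponent also makes the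
    amplitude at least 4^k. *)
Definition amplitude (k : nat) : nat := (2 ^ (k * k.+1))%N.

Lemma amplitude_gt0 k : (0 < amplitude k)%N. Proof. by rewrite expn_gt0. Qed.

Lemma amplitude_ge1 (R : realType) k : 1 <= (amplitude k)%:R :> R.
Proof. by rewrite ler1n amplitude_gt0. Qed.

Lemma leq_amplitude i k : (i <= k)%N -> (amplitude i <= amplitude k)%N.
Proof. by move=> ik; rewrite leq_exp2l// leq_mul. Qed.

(** Start from q0 with q0 ||q0 alpha|| tiny and take q = c q0 with c large: then
    q gam, where gam = q alpha - p, is still tiny, so some multiple a of it brings
    K (a q) gam within d of e.  The frequency is a q: its rotation angle
    a gam is about e / (K q), which is small because q is large. *)
Lemma approximation_step (R : realType) (alpha : R) : irrational alpha ->
  unbounded_partial_quotients alpha -> forall (e d : R) (K C : nat),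
  (0 < K)%N -> (0 < C)%N -> 0 < d ->
  exists (q : nat) (p a : int), let gam := q%:R * alpha - p%:~R in
    [/\ (0 < q)%N, K%:R * C%:R * `|gam| <= d,
        `|K%:R * ((a * q)%:~R * gam) - e| <= d &
        K%:R * C%:R * `|a%:~R * gam| <= d].
Proof.
move=> irr unb e d K C K0 C0 d0.
have KR : 1 <= K%:R :> R by rewrite ler1n.
have CR : 1 <= C%:R :> R by rewrite ler1n.
pose c := (Num.bound ((`|e| + d) * C%:R / d)).+1.
have cP : (`|e| + d) * C%:R / d < c%:R.
  apply: lt_le_trans (archi_boundP _) _; last by rewrite ler_nat.
  by rewrite divr_ge0 ?mulr_ge0 ?addr_ge0// ltW.
have cR : 1 <= c%:R :> R by rewrite ler1n.
have e0 : 0 < d / (K%:R * C%:R * c%:R ^+ 2).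
  by rewrite divr_gt0// !mulr_gt0// ?exprn_gt0//; lra.
have [q0 [p0 [q00 d00 qd]]] := good_approximation irr unb e0.
set d1 := _ - _ in d00 qd.
pose q := (c * q0)%N; pose gam := q%:R * alpha - (c%:Z * p0)%:~R.
have gamE : gam = c%:R * d1.
  by rewrite /gam /d1 /q natrM rmorphM/= mulrBr !mulrA.
have gam0 : gam != 0 by rewrite gamE mulf_neq0// pnatr_eq0.
have q_gt0 : (0 < q)%N by rewrite muln_gt0.
have qR : 0 < q%:R :> R by rewrite ltr0n.
have qgam : K%:R * C%:R * (q%:R * `|gam|) < d.
  move: qd; rewrite ltr_pdivlMr; last by rewrite !mulr_gt0// ?exprn_gt0//; lra.
  apply: le_lt_trans; rewrite gamE natrM normrM (ger0_norm (_ : 0 <= c%:R))//.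
  by rewrite le_eqVlt; apply/orP; left; apply/eqP; ring.
have Kqgam : K%:R * (q%:R * `|gam|) < d.
  apply: le_lt_trans qgam; rewrite ler_wpM2r ?mulr_ge0//.
  by rewrite ler_peMr.
pose a := Num.floor (e / (K%:R * (q%:R * gam))).
have aE : `|K%:R * ((a * q)%:~R * gam) - e| <= K%:R * (q%:R * `|gam|).
  have Kqg0 : K%:R * (q%:R * gam) != 0.
    by rewrite !mulf_neq0// ?gt_eqF//; lra.
  have -> : K%:R * ((a * q)%:~R * gam) - e =
     - (K%:R * (q%:R * gam)) * (e / (K%:R * (q%:R * gam)) - a%:~R).
    have E : K%:R * (q%:R * gam) * (e / (K%:R * (q%:R * gam))) = e.
      by rewrite [LHS]mulrCA divff// mulr1.
    rewrite rmorphM/= -[(q%:Z)%:~R]/(q%:R : R) [in RHS]mulrBr [in RHS]mulNr E.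
    by ring.
  rewrite normrM normrN normrM normrM !(ger0_norm (_ : 0 <= _%:R))//.
  apply: ler_piMr; first by rewrite !mulr_ge0.
  have := floor_itv (e / (K%:R * (q%:R * gam))); rewrite -/a rmorphD/=.
  move=> /andP[h1 h2]; rewrite ger0_norm; lra.
exists q, (c%:Z * p0), a; rewrite /= -/gam; split => //.
- apply: le_trans (ltW qgam); rewrite ler_wpM2l ?mulr_ge0//.
  by rewrite ler_peMl// ler1n.
- exact: le_trans aE (ltW Kqgam).
- have h : K%:R * `|a%:~R * gam| * q%:R <= `|e| + d.
    have -> : K%:R * `|a%:~R * gam| * q%:R = `|K%:R * ((a * q)%:~R * gam)|.
      have -> : K%:R * ((a * q)%:~R * gam) = K%:R * (a%:~R * gam) * q%:R.
        by rewrite rmorphM/= -[(q%:Z)%:~R]/(q%:R : R); ring.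
      rewrite [RHS]normrM [in RHS]normrM (ger0_norm (_ : 0 <= K%:R))//.
      by rewrite (ger0_norm (_ : 0 <= q%:R)).
    have := ler_normD (K%:R * ((a * q)%:~R * gam) - e) e; rewrite subrK.
    by move: aE Kqgam; lra.
  have qc : c%:R <= q%:R :> R by rewrite ler_nat leq_pmulr.
  have {}cP : (`|e| + d) * C%:R < q%:R * d.
    by move: cP; rewrite ltr_pdivrMr// => /lt_le_trans -> //; rewrite ler_pM2r.
  rewrite -(ler_pM2r qR) [d * _]mulrC; apply: le_trans (ltW cP).
  set X := `|_| in h *; rewrite (_ : _ * _ * _ * _ = K%:R * X * q%:R * C%:R).
    by rewrite ler_pM2r//; lra.
  by ring.
Qed.

(** [theta k] and [drift i k] are the representatives close to 0, modulo 1, of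
    freq_k alpha and of return_time_k freq_i alpha.  The bound [drift_small] says
    that over the k-th return time the k-th sawtooth moves by e_k and the others
    together by a negligible amount. *)
Record frequency_data (R : realType) (alpha : R) (e : nat -> R) := FrequencyData {
  return_time : nat -> nat ;
  freq : nat -> int ;
  theta : nat -> R ;
  drift : nat -> nat -> R ;
  thetaP : forall k, (freq k)%:~R * alpha - theta k \is a Num.int ;
  theta0 : forall k, freq k = 0 -> theta k = 0 ;
  theta_small : forall k, (amplitude k)%:R * `|theta k| <= 2 ^- (k + k) ;
  return_timeP : forall k, exists p : int, `|(return_time k)%:R * alpha - p%:~R| <= 2 ^- k ;
  driftP : forall i k,
    (return_time k)%:R * ((freq i)%:~R * alpha) - drift i k \is a Num.int ;
  drift0 : forall i k, freq i = 0 -> drift i k = 0 ;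
  drift_small : forall i k,
    `|(amplitude i)%:R * drift i k - (if i == k then e k else 0)| <= 2 ^- (i + k)
}.

(** The stages are chosen one after the other.  The state Cs k bounds all return
    times and frequencies of the earlier stages, and [approximation_step] is
    applied with this bound: a small gam_k controls the drift of the earlier
    sawtooth functions over the new return time, a small theta_k the drift of
    the new one over the earlier return times. *)
Lemma frequency_data_exists (R : realType) (alpha : R) (e : nat -> R) :
  irrational alpha -> unbounded_partial_quotients alpha ->
  inhabited (frequency_data alpha e).
Proof.
move=> irr unb.
pose good k C (x : nat * int * int) :=
  let gam := x.1.1%:R * alpha - x.1.2%:~R in
  let d := 2 ^- (k + k) : R in
    [/\ (0 < x.1.1)%N, (amplitude k)%:R * C%:R * `|gam| <= d,
        `|(amplitude k)%:R * ((x.2 * x.1.1)%:~R * gam) - e k| <= d &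
        (amplitude k)%:R * C%:R * `|x.2%:~R * gam| <= d].
have /choice[f fP] : forall kC : nat * nat, exists x, good kC.1 kC.2.+1 x.
  move=> [k C]; have d0 : 0 < 2 ^- (k + k) :> R by rewrite invr_gt0 exprn_gt0.
  have [q [p [a h]]] :=
    approximation_step irr unb (e k) (amplitude_gt0 k) (ltn0Sn C) d0.
  by exists (q, p, a).
pose nxt k C := let x := f (k, C) in (C + x.1.1 + `|(x.2 * x.1.1)%R|)%N.
pose Cs := fix Cs k := if k is j.+1 then nxt j (Cs j) else 0%N.
pose x k := f (k, Cs k).
pose n k := (x k).1.1; pose l k := (x k).2 * (x k).1.1.
pose gam k := (n k)%:R * alpha - (x k).1.2%:~R.
pose th k := (x k).2%:~R * gam k.
have CsS k : Cs k.+1 = (Cs k + n k + `|l k|)%N by [].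
have Csle i k : (i < k)%N -> (n i <= Cs k)%N /\ (`|l i| <= Cs k)%N.
  elim: k => // k IH; rewrite ltnS leq_eqVlt CsS => /orP[/eqP->|/IH]; lia.
have nP k : [/\ (0 < n k)%N, (amplitude k)%:R * (Cs k).+1%:R * `|gam k| <= 2 ^- (k + k),
    `|(amplitude k)%:R * ((l k)%:~R * gam k) - e k| <= 2 ^- (k + k) &
    (amplitude k)%:R * (Cs k).+1%:R * `|th k| <= 2 ^- (k + k)] := fP (k, Cs k).
have pow i k j : (j <= i)%N -> (k <= i)%N -> 2 ^- (i + i) <= 2 ^- (j + k) :> R.
  move=> ji ki; rewrite lef_pV2 ?posrE ?exprn_gt0//.
  by rewrite ler_weXn2l ?ler1n// leq_add.
have thE k : (l k)%:~R * alpha - th k \is a Num.int.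
  rewrite /th /gam /l rmorphM/= -[((x k).1.1%:Z)%:~R]/((n k)%:R : R).
  rewrite (_ : _ - _ = ((x k).2 * (x k).1.2)%:~R) ?rpred_int//.
  by rewrite rmorphM/=; ring.
have gE k i : (n k)%:R * ((l i)%:~R * alpha) - (l i)%:~R * gam k \is a Num.int.
  rewrite (_ : _ - _ = (l i * (x k).1.2)%:~R) ?rpred_int//.
  by rewrite [RHS]rmorphM/= /gam; move: (l i) (n k) => a b; ring.
have tE k i : (n k)%:R * ((l i)%:~R * alpha) - (n k)%:R * th i \is a Num.int.
  by rewrite -mulrBr rpredM// rpred_nat.
have l0 k : l k = 0 -> (x k).2 = 0.
  have [n0 _ _ _] := nP k; rewrite /l => /eqP; rewrite mulf_eq0 => /orP[/eqP//|].
  by move: n0; rewrite /n; lia.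
exists; exists n l th (fun i k => if (i <= k)%N then (l i)%:~R * gam k else (n k)%:R * th i).
- exact: thE.
- by move=> k /l0; rewrite /th => ->; rewrite mul0r.
- move=> k; have [_ _ _ h] := nP k; apply: le_trans h; rewrite ler_wpM2r//.
  by rewrite ler_peMr// ler1n.
- move=> k; exists (x k).1.2; rewrite -/(gam k); have [_ h _ _] := nP k.
  apply: le_trans (pow k k 0%N _ _); last 2 first. by []. by [].
  apply: le_trans h; rewrite ler_peMl//.
  by rewrite -natrM ler1n muln_gt0 amplitude_gt0.
- by move=> i k; case: ifP.
- move=> i k li0; case: ifP => _; first by rewrite li0 mul0r.
  by rewrite /th (l0 _ li0) mul0r mulr0.
- move=> i k; have [ik|ik|->] := ltngtP i k.
  + rewrite subr0 normrM ger0_norm// normrM.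
    have [_ h _ _] := nP k; apply: le_trans (pow k k i _ _); [|exact: ltnW|by []].
    apply: le_trans h; have [_ lC] := Csle _ _ ik.
    rewrite -mulrA; apply: ler_pM; rewrite ?mulr_ge0// ?ler_nat ?leq_amplitude 1?ltnW//.
    by rewrite ler_wpM2r// -intr_norm -natr_absz ler_nat ltnW.
  + rewrite subr0 normrM ger0_norm// normrM ger0_norm//.
    have [_ _ _ h] := nP i; apply: le_trans (pow i k i _ _); [|by []|exact: ltnW].
    apply: le_trans h; have [nC _] := Csle _ _ ik.
    by rewrite mulrA ler_wpM2r// ler_wpM2l// ler_nat ltnW.
  + by have [_ _ h _] := nP k.
Qed.

(** * Translation-invariant measures on the line *)

Section intervals.
Context {R : realType}.
Implicit Types m : {measure set (measurableTypeR R) -> \bar R}.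

(** Half-open intervals as measurable sets of [measurableTypeR R]: with the type
    fixed, products of intervals are elaborated as sets of pairs. *)
Definition oc (a b : R) : set (measurableTypeR R) := (`]a, b]%classic : set R).

Lemma measurable_oc (a b : R) : measurable (oc a b).
Proof. exact: measurable_itv. Qed.

Lemma lebesgue_oc (a b : R) : a <= b -> lebesgue_measure (oc a b) = (b - a)%:E.
Proof.
rewrite le_eqVlt => /orP[/eqP->|ab]; last by rewrite lebesgue_measure_itv/= lte_fin ab EFinB.
by rewrite lebesgue_measure_itv/= lte_fin ltxx subrr.
Qed.

Lemma ocE (a b x : R) : oc a b x = (a < x <= b) :> Prop.
Proof. by rewrite /oc/= in_itv. Qed.

(** The half-open intervals form a generating pi-system of Lebesgue's
    sigma-algebra. *)
Lemma measure_unique_oc m1 m2 :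
  (forall a b, a <= b -> m1 (oc a b) = m2 (oc a b)) ->
  (forall a b, a <= b -> (m1 (oc a b) < +oo)%E) ->
  forall A, measurable A -> m1 A = m2 A.
Proof.
move=> m12 fin A mA.
have mG : (measurable : set (set (measurableTypeR R))) = <<s @ocitv R >> by [].
apply: (@measure_unique _ R (measurableTypeR R) (@ocitv R)
  (fun n => `](- n%:R), n%:R]%classic) mG _ _ _ m1 m2) => //.
- exact: ocitvI.
- by move=> n; exact: is_ocitv.
- apply/seteqP; split=> // x _.
  exists (Num.bound `|x|).+1 => //=; rewrite in_itv/=.
  have := archi_boundP (normr_ge0 x); rewrite -natr1.
  by have /ler_normlP[] := lexx `|x|; move=> *; apply/andP; split; lra.
- move=> X /ocitvP[->|[[a b] /= ab ->]]; first by rewrite !measure0.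
  exact/m12/ltW.
- by move=> n; apply: fin; rewrite lerNl (le_trans _ (ler0n _ n))// lerNl oppr0.
Qed.

Lemma archimedean_bound0 (x C : R) : (forall n : nat, n%:R * x <= C) -> x <= 0.
Proof.
move=> h; rewrite leNgt; apply/negP => x0.
have := h (Num.bound (`|C| / x)).
rewrite leNgt => /negP; apply; rewrite -ltr_pdivrMr//.
apply: le_lt_trans (archi_boundP _).
  by rewrite ler_pM2r ?invr_gt0// ler_norm.
by rewrite divr_ge0// ltW.
Qed.

(** Arbitrarily short translations generate a dense group, and F(a, b) = m ]a, b]
    is Lipschitz in both ends; so m is invariant under all translations.  Then
    G(t) = m ]0, t] is additive, and |n G(t) - n t G(1)| stays bounded in n, which
    forces G(t) = t G(1). *)
Lemma translation_invariant_measure m (C : R) : 0 <= C ->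
  (forall a b, a <= b -> (m (oc a b) <= (C * (b - a))%:E)%E) ->
  (forall eps, 0 < eps -> exists e, [/\ 0 < e, e < eps &
    forall a b, a <= b -> m (oc (a + e) (b + e)) = m (oc a b)]) ->
  forall A, measurable A -> m A = (m (oc 0%R 1%R) * lebesgue_measure A)%E.
Proof.
move=> C0 mC inv.
have fin a b : a <= b -> m (oc a b) \is a fin_num.
  by move=> /mC h; rewrite ge0_fin_numE// (le_lt_trans h)// ltry.
pose F a b := fine (m (oc a b)).
have FE a b : a <= b -> m (oc a b) = (F a b)%:E.
  by move=> ab; rewrite /F fineK// fin.
have F0 a b : 0 <= F a b by rewrite fine_ge0.
have FC a b : a <= b -> F a b <= C * (b - a).
  by move=> ab; rewrite -lee_fin -FE// mC.
have Fadd a b c : a <= b -> b <= c -> F a b + F b c = F a c.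
  move=> ab bc; have ac := le_trans ab bc.
  have disj : (oc a b) `&` (oc b c) = set0 :> set R.
    apply/seteqP; split=> // x []; rewrite !ocE => /andP[_ xb] /andP[bx _].
    by move: (lt_le_trans bx xb); rewrite ltxx.
  apply: EFin_inj; rewrite EFinD -!FE// -measureU; last exact: disj.
  - by congr (m _); rewrite /oc -itv_bndbnd_setU//= bnd_simp.
  - exact: measurable_oc.
  - exact: measurable_oc.
have Fclose a b t : 0 <= t -> a <= b -> `|F (a + t) (b + t) - F a b| <= C * t.
  move=> t0 ab.
  have := Fadd a b (b + t) ab (ltac:(lra)).
  have := Fadd a (a + t) (b + t) (ltac:(lra)) (ltac:(lra)).
  have := FC a (a + t) (ltac:(lra)); have := FC b (b + t) (ltac:(lra)).
  have := F0 a (a + t); have := F0 b (b + t).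
  rewrite (_ : b + t - b = t); last by ring.
  rewrite (_ : a + t - a = t); last by ring.
  by move=> *; rewrite ler_norml; apply/andP; split; lra.
have Finv a b t : a <= b -> 0 <= t -> F (a + t) (b + t) = F a b.
  move=> ab t0; apply/eqP; rewrite -subr_eq0 -normr_le0.
  apply/ler_addgt0Pr => eps eps0; rewrite add0r.
  have [|e [e0 eeps he]] := inv (eps / (C + 1)); first by rewrite divr_gt0//; lra.
  have Fn n : F (a + n%:R * e) (b + n%:R * e) = F a b.
    elim: n => [|n IH]; first by rewrite mul0r !addr0.
    rewrite -IH /F -(he (a + n%:R * e) (b + n%:R * e)); last by rewrite lerD2r.
    by rewrite -natr1 mulrDl mul1r !addrA.
  pose n := Num.trunc (t / e).
  have /andP[n1 n2] : n%:R * e <= t < n.+1%:R * e.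
    rewrite -ler_pdivlMr// -ltr_pdivrMr//; apply: truncn_itv.
    by rewrite divr_ge0// ltW.
  rewrite -(Fn n).
  rewrite (_ : a + t = (a + n%:R * e) + (t - n%:R * e)); last by ring.
  rewrite (_ : b + t = (b + n%:R * e) + (t - n%:R * e)); last by ring.
  apply: le_trans (Fclose _ _ _ _ _) _; [by rewrite subr_ge0|by rewrite lerD2r|].
  have : t - n%:R * e <= e by move: n2; rewrite -natr1 mulrDl mul1r; lra.
  move=> h; apply: (@le_trans _ _ (C * e)); first by rewrite ler_wpM2l.
  move: eeps; rewrite ltr_pdivlMr; last by lra.
  by nra.
pose G t := F 0 t.
have FG a b : a <= b -> F a b = G (b - a).
  move=> ab; have ba : 0 <= b - a by rewrite subr_ge0.
  have [a0|a0] := leP 0 a.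
    by rewrite /G -(Finv 0 (b - a) a)// add0r subrK.
  rewrite /G -(Finv a b (- a))//; last by rewrite oppr_ge0 ltW.
  by rewrite subrr.
have Gadd s t : 0 <= s -> 0 <= t -> G (s + t) = G s + G t.
  move=> s0 t0; rewrite /G -(Fadd 0 s (s + t))//; last by lra.
  by rewrite (FG s)//; [congr (_ + F _ _); ring|lra].
have GM n t : 0 <= t -> G (n%:R * t) = n%:R * G t.
  move=> t0; elim: n => [|n IH].
    have := Gadd 0 0 (lexx _) (lexx _); rewrite addr0 !mul0r; lra.
  by rewrite -natr1 mulrDl mul1r Gadd ?IH ?mulr_ge0//; ring.
have GE t : 0 <= t -> G t = t * G 1.
  move=> t0; apply/eqP; rewrite -subr_eq0 -normr_le0.
  apply: (@archimedean_bound0 _ C) => n.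
  have nt0 : 0 <= n%:R * t by rewrite mulr_ge0.
  rewrite -[X in X * _](@ger0_norm _ n%:R)// -normrM mulrBr -GM// mulrA.
  pose N := Num.trunc (n%:R * t); have /andP[N1 N2] := truncn_itv nt0.
  rewrite -/N in N1 N2.
  have r0 : 0 <= n%:R * t - N%:R by rewrite subr_ge0.
  have -> : G (n%:R * t) = N%:R * G 1 + G (n%:R * t - N%:R).
    by rewrite -GM// mulr1 -Gadd//; congr G; ring.
  set r := n%:R * t - N%:R in r0 *.
  have r1 : r <= 1 by move: N2; rewrite -natr1 /r; lra.
  have -> : N%:R * G 1 + G r - n%:R * t * G 1 = G r - r * G 1 by rewrite /r; ring.
  have := FC 0 r r0; have := FC 0 1 ler01; rewrite !subr0 mulr1.
  have := F0 0 r; have := F0 0 1; rewrite -/(G r) -/(G 1) => G1 Gr G1C GrC.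
  rewrite ler_norml; apply/andP; split; nra.
have mE a b : a <= b -> m (oc a b) =
    (m (oc 0%R 1%R) * lebesgue_measure (oc a b))%E.
  move=> ab; rewrite lebesgue_oc// !FE// FG// GE ?subr_ge0// -/(G 1).
  by rewrite -EFinM mulrC.
have k0 : 0 <= F 0 1 by [].
move=> A mA; rewrite FE//.
apply: (@measure_unique_oc m (mscale (NngNum k0) lebesgue_measure)) => //.
  by move=> a b ab; rewrite mE// FE.
by move=> a b ab; rewrite FE// ltry.
Qed.

End intervals.

(** * Skew products over a measure space *)

Lemma measurable_translation (R : realType) (t : R) :
  measurable_fun setT ((fun x : R => x + t) : measurableTypeR R -> measurableTypeR R).
Proof. by apply: measurable_funD => //; exact: measurable_id. Qed.

Lemma lebesgue_measure_translation (R : realType) (t : R)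
    (A : set (measurableTypeR R)) : measurable A ->
  lebesgue_measure ((fun x : R => x + t) @^-1` A) = lebesgue_measure A.
Proof.
move=> mA; have mt := measurable_translation t.
pose mu := pushforward (@lebesgue_measure R) (fun x : measurableTypeR R => (x + t : measurableTypeR R)).
apply: (@measure_unique_oc _ mu) => // a b ab; rewrite /mu /= /pushforward; last first.
  rewrite (_ : _ @^-1` _ = `]a - t, b - t]%classic).
    by rewrite lebesgue_measure_itv/= lte_fin ltrD2r; case: ifP => // _; rewrite -EFinB ltry.
  by apply/seteqP; split=> x /=; rewrite !in_itv/= ltrBlDr lerBrDr.
rewrite (_ : _ @^-1` _ = `]a - t, b - t]%classic).
  rewrite !lebesgue_measure_itv/= !lte_fin ltrD2r -!EFinB.
  by congr (if _ then _%:E else _); ring.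
by apply/seteqP; split=> x /=; rewrite !in_itv/= ltrBlDr lerBrDr.
Qed.

Section skew.
Context d (T : measurableType d) (R : realType).
Context (mu : {measure set T -> \bar R}).

Lemma measurable_skew (f : T -> T) (S : T -> measurableTypeR R) :
  measurable_fun setT f -> measurable_fun setT S ->
  measurable_fun setT (fun z : T * measurableTypeR R => (f z.1, z.2 + S z.1) : T * measurableTypeR R).
Proof.
move=> mf mS; apply/measurable_fun_pairP; split=> /=.
  exact: (measurableT_comp mf measurable_fst).
apply: measurable_funD; first exact: measurable_snd.
exact: (measurableT_comp mS measurable_fst).
Qed.

(** On each vertical fibre the map is a translation, so this is Fubini. *)
Lemma skew_measure_preserving (S : T -> measurableTypeR R) (E : set (T * measurableTypeR R)) :
  measurable_fun setT S -> measurable E ->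
  (mu \x lebesgue_measure)%E ((fun z => (z.1, z.2 + S z.1)) @^-1` E) =
  (mu \x lebesgue_measure)%E E.
Proof.
move=> mS mE; rewrite /product_measure1; apply: eq_integral => x _ /=.
rewrite -(@lebesgue_measure_translation _ (S x) (xsection E x)); last first.
  exact: measurable_xsection.
have -> // : xsection ((fun z => (z.1, z.2 + S z.1)) @^-1` E) x =
  (fun y : R => y + S x) @^-1` xsection E x.
by apply/seteqP; split => y; rewrite /xsection/= !inE.
Qed.

Lemma base_measure_preserving (f : T -> T) (E : set (T * measurableTypeR R)) :
  measurable_fun setT f -> (forall A, measurable A -> mu (f @^-1` A) = mu A) ->
  measurable E ->
  (mu \x lebesgue_measure)%E ((fun z => (f z.1, z.2)) @^-1` E) =
  (mu \x lebesgue_measure)%E E.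
Proof.
move=> mf muf mE; rewrite /product_measure1.
have mxs := measurable_fun_xsection (@lebesgue_measure R) mE.
transitivity (\int[pushforward mu f]_x (lebesgue_measure \o xsection E) x)%E.
  by rewrite (ge0_integral_pushforward mf).
by apply: eq_measure_integral => A mA _; rewrite /= /pushforward muf.
Qed.

End skew.

Section ocitv_rectangles.
Context {R : realType}.
Local Notation mR := (measurableTypeR R).

Let box n : set mR := `](- (n%:R)), (n%:R : R)]%classic.

Let box_cover x : exists n0, forall n, (n0 <= n)%N -> box n x.
Proof.
exists (Num.bound `|x|) => n hn; rewrite /box/= in_itv/=.
have h1 : `|x| < n%:R.
  by apply: lt_le_trans (archi_boundP (normr_ge0 x)) _; rewrite ler_nat.
by move: h1; rewrite ltr_norml => /andP[-> /ltW].
Qed.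

(** Rectangles with half-open sides suffice to determine a measure: fixing one
    side of the rectangle reduces to the one-dimensional statement, first in one
    coordinate and then in the other. *)
Lemma measure_unique_oc2 (m1 m2 : {measure set (mR * mR) -> \bar R}) :
  (forall a b c d : R, (a <= b)%R -> (c <= d)%R ->
    m1 (oc a b `*` oc c d) = m2 (oc a b `*` oc c d)) ->
  (forall a b c d : R, (a <= b)%R -> (c <= d)%R ->
    (m1 (oc a b `*` oc c d) < +oo)%E) ->
  forall A, measurable A -> m1 A = m2 A.
Proof.
move=> m12 fin.
have nn (n : nat) : - n%:R <= n%:R :> R by rewrite lerNl (le_trans _ (ler0n _ n))// lerNl oppr0.
have mtop (D : set mR) : measurable D -> measurable ([set: mR] `*` D) by move=> mD; exact: measurableX.
have step1 V (c d : R) : measurable V -> (c <= d)%R ->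
    m1 (V `*` oc c d) = m2 (V `*` oc c d).
  move=> mV cd; have mH := mtop _ (measurable_oc c d).
  pose n1 := pushforward (mrestr m1 mH) (@fst mR mR).
  pose n2 := pushforward (mrestr m2 mH) (@fst mR mR).
  have nE (m : {measure set (mR * mR) -> \bar R}) A :
      pushforward (mrestr m mH) (@fst mR mR) A = m (A `*` oc c d).
    by rewrite /pushforward /mrestr; congr (m _); apply/seteqP; split => -[x y] /=; tauto.
  have mf : measurable_fun setT (@fst mR mR) := measurable_fst.
  rewrite -!nE; apply: (@measure_unique_oc _ n1 n2) => // a b ab.
    by rewrite /n1 /n2 /= !nE m12.
  by rewrite /n1 /= nE fin.
have step2 n V B : measurable V -> measurable B ->
    m1 ((V `&` box n) `*` B) = m2 ((V `&` box n) `*` B).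
  move=> mV mB; have mVb : measurable (V `&` box n) by apply: measurableI => //; exact: measurable_oc.
  have mH : measurable ((V `&` box n) `*` [set: mR]) by exact: measurableX.
  (* The window makes the measures of these rectangles finite. *)
  pose n1 := pushforward (mrestr m1 mH) (@snd mR mR).
  pose n2 := pushforward (mrestr m2 mH) (@snd mR mR).
  have nE (m : {measure set (mR * mR) -> \bar R}) A :
      pushforward (mrestr m mH) (@snd mR mR) A = m ((V `&` box n) `*` A).
    by rewrite /pushforward /mrestr; congr (m _); apply/seteqP; split => -[x y] /=; tauto.
  have mf : measurable_fun setT (@snd mR mR) := measurable_snd.
  rewrite -!nE; apply: (@measure_unique_oc _ n1 n2) => // a b ab.
    by rewrite /n1 /n2 /= !nE step1.
  rewrite /n1 /= nE; apply: le_lt_trans (fin _ _ _ _ (nn n) ab).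
  apply: le_measure; rewrite ?inE.
  - by apply: measurableX => //; exact: measurable_oc.
  - by apply: measurableX => //; exact: measurable_oc.
  - by move=> [x y] /= [[]].
pose G : set (set (mR * mR)) :=
  [set C | exists n A B, [/\ measurable A, measurable B & C = (A `&` box n) `*` B]].
have mG : measurable = <<s G >>.
  rewrite measurable_prod_measurableType; apply/seteqP; split; apply: smallest_sub.
  - exact: smallest_sigma_algebra.
  - move=> _ [A mA [B mB <-]].
    rewrite (_ : A `*` B = \bigcup_n ((A `&` box n) `*` B)).
      apply: sigma_algebra_bigcup => n; apply: sub_sigma_algebra.
      by exists n, A, B.
    apply/seteqP; split=> [[x y] /= [Ax By]|[x y] [n _] /= [[]]//].
    by have [n0 h] := box_cover x; exists n0 => //; split => //; split => //; exact: h.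
  - exact: smallest_sigma_algebra.
  - move=> _ [n [A [B [mA mB ->]]]]; apply: sub_sigma_algebra.
    exists (A `&` box n); last by exists B.
    by apply: measurableI => //; exact: measurable_oc.
move=> A mA; apply: (@measure_unique _ R _ G (fun n => box n `*` box n) mG) => //.
- move=> _ _ [n [X1 [X2 [mX1 mX2 ->]]]] [k [Y1 [Y2 [mY1 mY2 ->]]]].
  exists k, ((X1 `&` box n) `&` Y1), (X2 `&` Y2); split.
  + by apply: measurableI => //; apply: measurableI => //; exact: measurable_oc.
  + exact: measurableI.
  + by rewrite -setXI setIA.
- move=> n; exists n, setT, (box n); rewrite setTI; split=> //.
  exact: measurable_oc.
- apply/seteqP; split=> // -[x y] _.
  have [n1 h1] := box_cover x; have [n2 h2] := box_cover y.
  by exists (maxn n1 n2) => //; split; [apply: h1; exact: leq_maxl|apply: h2; exact: leq_maxr].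
- by move=> _ [n [X1 [X2 [mX1 mX2 ->]]]]; exact: step2.
- by move=> n; exact: fin.
Qed.

End ocitv_rectangles.

(** * Uniqueness of the invariant measure under rigidity *)

Section rigidity.
Context {R : realType}.
Local Notation mR := (measurableTypeR R).
Local Notation leb := (@lebesgue_measure R).
Local Notation leb2 := (leb \x leb)%E.

Definition birkhoff (alpha : R) (phi : R -> R) (n : nat) (x : R) : R :=
  \sum_(j < n) phi (x + j%:R * alpha).

Lemma measurable_birkhoff alpha (phi : mR -> mR) n : measurable_fun setT phi ->
  measurable_fun setT (birkhoff alpha phi n : mR -> mR).
Proof.
move=> mphi; apply: measurable_sum => j.
by apply: (measurableT_comp mphi); exact: measurable_translation.
Qed.

Context (alpha : R) (phi : mR -> mR).
Context (mphi : measurable_fun setT phi).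
Context (alpha_approx : forall e : R, 0 < e -> exists (q : nat) (p : int),
  let d := q%:R * alpha - p%:~R in d != 0 /\ `|d| < e).
Context (rigid : forall (r : rat) (N : nat) (eps : R), 0 < eps ->
  exists (n : nat) (p : int) (Bad : set mR),
    [/\ `|n%:R * alpha - p%:~R| <= eps, measurable Bad, (leb Bad <= eps%:E)%E &
      forall x, `|x| <= N%:R -> ~ Bad x -> `|birkhoff alpha phi n x - ratr r| <= eps]).

Context (m : {measure set (mR * mR) -> \bar R}).
Context (m_le : forall E, measurable E -> (m E <= leb2 E)%E).
Context (m_flow : forall E, measurable E ->
  m ((fun z : mR * mR => (z.1 + alpha, z.2 + phi z.1) : mR * mR) @^-1` E) = m E).
Context (m_period : forall E, measurable E ->
  m ((fun z : mR * mR => (z.1 + 1, z.2) : mR * mR) @^-1` E) = m E).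

Let skew (t : R) (S : mR -> mR) (z : mR * mR) : mR * mR := (z.1 + t, z.2 + S z.1).

Let mskew t S : measurable_fun setT S -> measurable_fun setT (skew t S).
Proof. by move=> mS; apply: (measurable_skew (measurable_translation t) mS). Qed.

Let mskew_preimage t S E : measurable_fun setT S -> measurable E ->
  measurable (skew t S @^-1` E).
Proof. by move=> mS mE; rewrite -[X in measurable X]setTI; exact: (mskew t mS). Qed.

Let m_iter n E : measurable E ->
  m (skew (n%:R * alpha) (birkhoff alpha phi n) @^-1` E) = m E.
Proof.
elim: n E => [|n IH] E mE.
  congr (m _); apply/seteqP; split => -[x y];
    by rewrite /skew/= /birkhoff big_ord0 mul0r !addr0.
rewrite -(m_flow mE) -[RHS]IH; last first.
  exact: (mskew_preimage alpha mphi mE).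
congr (m _); apply/seteqP; split => -[x y];
  by rewrite /skew/= /birkhoff big_ord_recr/= -natr1 mulrDl mul1r !addrA.
Qed.

Let m_integer (p : int) E : measurable E ->
  m (skew (p%:~R) (cst 0) @^-1` E) = m E.
Proof.
have nat_case (n : nat) F : measurable F -> m (skew n%:R (cst 0) @^-1` F) = m F.
  elim: n F => [|n IH] F mF.
    by congr (m _); apply/seteqP; split => -[x y]; rewrite /skew/= !addr0.
  rewrite -(m_period mF) -[RHS]IH.
    by congr (m _); apply/seteqP; split => -[x y]; rewrite /skew/= -natr1 !addr0 !addrA.
  rewrite (_ : (fun _ => _) = skew 1 (cst 0)); last by apply/funext => -[x y]; rewrite /skew/= addr0.
  exact: mskew_preimage.
move=> mE; case: p => n; first exact: nat_case.
rewrite -[LHS](nat_case n.+1); last exact: mskew_preimage.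
congr (m _); apply/seteqP; split => -[x y]; rewrite /skew/= !addr0 NegzE mulrNz;
  by rewrite -addrA subrr addr0.
Qed.

Let m_return n (p : int) E : measurable E ->
  m (skew (n%:R * alpha - p%:~R) (birkhoff alpha phi n) @^-1` E) = m E.
Proof.
move=> mE; have mb := measurable_birkhoff alpha n mphi.
rewrite -[RHS](m_integer (- p)) // -[RHS](m_iter n); last exact: mskew_preimage.
congr (m _); apply/seteqP; split => -[x y]; rewrite /skew/= addr0 mulrNz !addrA//.
Qed.

Let leb2E (A B : set mR) : measurable A -> measurable B ->
  leb2 (A `*` B) = (leb A * leb B)%E.
Proof. by move=> mA mB; rewrite product_measure1E. Qed.

(** V x (H - r) is almost contained in the preimage of V x H under a return to
    near the identity with vertical displacement close to r.  The points missed
    have their abscissa near an end of V or in the bad set (both collected in X),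
    or their ordinate near an end of H - r (collected in Y). *)
Let m_shift_le (r : rat) (a b c d : R) : a <= b -> c <= d ->
  (m (oc a b `*` oc (c - ratr r) (d - ratr r)) <= m (oc a b `*` oc c d))%E.
Proof.
move=> ab cd; apply/lee_addgt0Pr => eta eta0.
pose W : R := 3 * (d - c) + (b - a) * 2 + 1.
have W0 : 0 < W by rewrite /W; lra.
pose eps := eta / W.
have eps0 : 0 < eps by rewrite divr_gt0.
pose N := Num.bound (`|a| + `|b|).
have [n [p [Bad [g1 mB B1 B2]]]] := rigid r N eps0.
set gam := _ - _ in g1.
have mb := measurable_birkhoff alpha n mphi.
set V := oc a b; set H := oc c d; set H' := oc (c - ratr r) (d - ratr r).
pose X := (oc a (a + eps) `|` oc (b - eps) b) `|` Bad.
pose Y := oc (c - ratr r) (c - ratr r + eps) `|` oc (d - ratr r - eps) (d - ratr r).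
pose P := skew gam (birkhoff alpha phi n) @^-1` (V `*` H).
have mV : measurable V by exact: measurable_oc.
have mH : measurable H by exact: measurable_oc.
have mH' : measurable H' by exact: measurable_oc.
have mX : measurable X by apply: measurableU => //; apply: measurableU; exact: measurable_oc.
have mY : measurable Y by apply: measurableU; exact: measurable_oc.
have mP : measurable P by apply: mskew_preimage => //; exact: measurableX.
have sub : V `*` H' `<=` P `|` (X `*` H' `|` V `*` Y).
  move=> [x y] [/= Vx Hy]; have [Xx|nXx] := pselect (X x); first by right; left.
  have [Yy|nYy] := pselect (Y y); first by right; right.
  left; rewrite /P /skew/=.
  move: (Vx) (Hy) nXx nYy; rewrite /V /H /H' /X /Y /setU/= !ocE => /andP[x1 x2] /andP[y1 y2].
  move=> /not_orP[/not_orP[/negP+ /negP+] nB] /not_orP[/negP+ /negP+].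
  rewrite !negb_and -!leNgt -!ltNge => x3 x4 y3 y4.
  have {}x3 : a + eps < x by move: x3 => /orP[|//]; lra.
  have {}x4 : x <= b - eps by move: x4 => /orP[//|]; lra.
  have {}y3 : c - ratr r + eps < y by move: y3 => /orP[|//]; lra.
  have {}y4 : y <= d - ratr r - eps by move: y4 => /orP[//|]; lra.
  have xN : `|x| <= N%:R.
    apply: le_trans (ltW (archi_boundP _)); last by rewrite addr_ge0.
    have := ler_norm b; have := ler_norm (- a); rewrite normrN => *.
    by have := normr_ge0 a; have := normr_ge0 b; rewrite ler_norml => *; apply/andP; split; lra.
  move: g1 (B2 x xN nB); rewrite !ler_norml => /andP[g1 g1'] /andP[h1 h1'].
  split; apply/andP; split; lra.
have mXH : measurable (X `*` H') by exact: measurableX.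
have mVY : measurable (V `*` Y) by exact: measurableX.
apply: (@le_trans _ _ (m (P `|` (X `*` H' `|` V `*` Y)))).
  apply: le_measure => //; rewrite inE; first exact: measurableX.
  by apply: measurableU => //; exact: measurableU.
apply: (le_trans (measureU2 _ _ _)) => //; first exact: measurableU.
apply: leeD; first by rewrite -(m_return n p (measurableX mV mH)).
apply: (le_trans (measureU2 _ _ _)) => //.
have lebU (A B : set mR) : measurable A -> measurable B ->
  (leb (A `|` B) <= leb A + leb B)%E by exact: measureU2.
have lX : (leb X <= (3 * eps)%:E)%E.
  apply: (le_trans (lebU _ _ _ mB)); first by apply: measurableU; exact: measurable_oc.
  rewrite (_ : 3 * eps = 2 * eps + eps); last by ring.
  rewrite EFinD; apply: leeD => //.
  apply: (le_trans (lebU _ _ (measurable_oc _ _) (measurable_oc _ _))).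
  by rewrite !lebesgue_oc; [rewrite -EFinD lee_fin; lra|lra..].
have lY : (leb Y <= (2 * eps)%:E)%E.
  apply: (le_trans (lebU _ _ (measurable_oc _ _) (measurable_oc _ _))).
  by rewrite !lebesgue_oc; [rewrite -EFinD lee_fin; lra|lra..].
have h1 : (m (X `*` H') <= (3 * eps * (d - c))%:E)%E.
  apply: (le_trans (m_le mXH)); rewrite leb2E// EFinM; apply: lee_pmul => //.
  by rewrite /H' lebesgue_oc ?lee_fin; lra.
have h2 : (m (V `*` Y) <= ((b - a) * (2 * eps))%:E)%E.
  apply: (le_trans (m_le mVY)); rewrite leb2E// EFinM; apply: lee_pmul => //.
  by rewrite /V lebesgue_oc.
apply: (le_trans (leeD h1 h2)); rewrite -EFinD lee_fin.
have -> : eta = eps * W by rewrite /eps divfK// gt_eqF.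
rewrite /W; nra.
Qed.

(** The inequality above for r and for -r. *)
Let m_shift (r : rat) (a b c d : R) : a <= b -> c <= d ->
  m (oc a b `*` oc (c + ratr r) (d + ratr r)) = m (oc a b `*` oc c d).
Proof.
move=> ab cd; apply/eqP; rewrite eq_le; apply/andP; split.
  have := m_shift_le (- r) ab cd; rewrite rmorphN/= !opprK; exact.
have cd' : c + ratr r <= d + ratr r by rewrite lerD2r.
by have := m_shift_le r ab cd'; rewrite !addrK.
Qed.

Let finite_box (a b c d : R) : a <= b -> c <= d ->
  (m (oc a b `*` oc c d) <= ((b - a) * (d - c))%:E)%E.
Proof.
move=> ab cd; have mE : measurable (oc a b `*` oc c d).
  by apply: measurableX; exact: measurable_oc.
apply: (le_trans (m_le mE)); rewrite leb2E; try exact: measurable_oc.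
by rewrite !lebesgue_oc.
Qed.

(** By [m_shift] and [translation_invariant_measure], m is a product of its
    horizontal marginal kappa with Lebesgue measure.  The vertical component of
    the flow preserves any such product, so the invariance of m gives that of
    kappa under the rotation; together with the period 1 this contains the
    arbitrarily short translations q alpha - p. *)
Theorem rigid_measure_unique E : measurable E ->
  m E = (m (oc 0 1 `*` oc 0 1) * leb2 E)%E.
Proof.
have mstrip : measurable ([set: mR] `*` oc (0 : R) (1 : R)).
  by apply: measurableX => //; exact: measurable_oc.
have mf : measurable_fun setT (@fst mR mR) := measurable_fst.
pose kappa := pushforward (mrestr m mstrip) (@fst mR mR).
have kappaE A : kappa A = m (A `*` oc 0 1).
  by rewrite /kappa /pushforward /mrestr; congr (m _); apply/seteqP; split => -[x y] /=; tauto.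
have vert (a b c d : R) : a <= b -> c <= d ->
    m (oc a b `*` oc c d) = (kappa (oc a b) * leb (oc c d))%E.
  move=> ab cd; have mH : measurable (oc a b `*` [set: mR]).
    by apply: measurableX => //; exact: measurable_oc.
  have mg : measurable_fun setT (@snd mR mR) := measurable_snd.
  pose nu := pushforward (mrestr m mH) (@snd mR mR).
  have nuE A : nu A = m (oc a b `*` A).
    by rewrite /nu /pushforward /mrestr; congr (m _); apply/seteqP; split => -[x y] /=; tauto.
  rewrite -nuE kappaE -nuE; apply: (@translation_invariant_measure _ nu (b - a)).
  - by rewrite subr_ge0.
  - by move=> c' d' cd'; have := finite_box ab cd'; rewrite -nuE.
  - move=> eps eps0; exists (ratr ((Num.bound eps^-1).+1%:R^-1)).
    have bP : eps^-1 < (Num.bound eps^-1).+1%:R.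
      apply: lt_le_trans (archi_boundP _) _; first by rewrite invr_ge0 ltW.
      by rewrite ler_nat.
    rewrite fmorphV rmorph_nat; split; first by rewrite invr_gt0.
      by rewrite -[ltRHS]invrK ltf_pV2// posrE ?invr_gt0.
    move=> c' d' cd'; have := m_shift ((Num.bound eps^-1).+1%:R^-1) ab cd'.
    by rewrite -!nuE fmorphV rmorph_nat.
  - exact: measurable_oc.
have mkl (F : set (mR * mR)) : measurable F -> m F = (kappa \x leb)%E F.
  move=> mF; apply: (@measure_unique_oc2 _ m (kappa \x leb)%E) => // a b c d ab cd.
    by rewrite vert//= product_measure1E//; exact: measurable_oc.
  by apply: (le_lt_trans (finite_box ab cd)); rewrite ltry.
have kappa_phi (V : set mR) : measurable V -> kappa ((fun x : mR => x + alpha : mR) @^-1` V) = kappa V.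
  move=> mV; have mVa : measurable ((fun x : mR => x + alpha : mR) @^-1` V).
    by rewrite -[X in measurable X]setTI; exact: (measurable_translation alpha).
  have moc := measurable_oc (0 : R) 1.
  have mVo : measurable (V `*` oc (0 : R) 1) by exact: measurableX.
  rewrite [RHS]kappaE -(m_flow mVo) mkl; last exact: (mskew_preimage alpha mphi mVo).
  have mVao : measurable (((fun x : mR => x + alpha : mR) @^-1` V) `*` oc (0 : R) 1).
    exact: measurableX.
  (* The preimage of V x ]0, 1] under the flow is the preimage of
     (V - alpha) x ]0, 1] under a vertical skew translation. *)
  rewrite kappaE mkl// -[LHS](skew_measure_preserving _ mphi)//.
have kappa_1 (V : set mR) : measurable V -> kappa ((fun x : mR => x + (1 : R) : mR) @^-1` V) = kappa V.
  move=> mV; rewrite !kappaE -(m_period (_ : measurable (V `*` oc 0 1)))//.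
  by apply: measurableX => //; exact: measurable_oc.
have mtr t (V : set mR) : measurable V -> measurable ((fun x : mR => x + t : mR) @^-1` V).
  by move=> mV; rewrite -[X in measurable X]setTI; exact: (measurable_translation t).
have kappa_nat t :
    (forall V : set mR, measurable V -> kappa ((fun x : mR => x + t : mR) @^-1` V) = kappa V) ->
    forall (n : nat) (V : set mR), measurable V ->
    kappa ((fun x : mR => x + n%:R * t : mR) @^-1` V) = kappa V.
  move=> h; elim=> [|n IH] V mV.
    by congr kappa; apply/seteqP; split => x /=; rewrite mul0r addr0.
  rewrite -[RHS]h// -[RHS]IH; last exact: mtr.
  by congr kappa; apply/seteqP; split => x /=; rewrite -natr1 mulrDl mul1r addrA.
have kappa_opp t :
    (forall V : set mR, measurable V -> kappa ((fun x : mR => x + t : mR) @^-1` V) = kappa V) ->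
    forall V : set mR, measurable V -> kappa ((fun x : mR => x - t : mR) @^-1` V) = kappa V.
  move=> h V mV; rewrite -[LHS]h; last exact: mtr.
  by congr kappa; apply/seteqP; split => x /=; rewrite addrK.
have kappa_int (p : int) (V : set mR) : measurable V ->
    kappa ((fun x : mR => x + p%:~R : mR) @^-1` V) = kappa V.
  case: p V => n V mV; first by rewrite -[RHS](kappa_nat _ kappa_1 n)// mulr1.
  have := kappa_opp _ (kappa_nat _ kappa_1 n.+1) V mV; rewrite mulr1 => <-.
  by rewrite NegzE mulrNz.
have kappa_small q (p : int) (V : set mR) : measurable V ->
    kappa ((fun x : mR => x + (q%:R * alpha - p%:~R) : mR) @^-1` V) = kappa V.
  move=> mV; rewrite -[RHS](kappa_nat _ kappa_phi q)// -[RHS](kappa_int (- p)); last exact: mtr.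
  by congr kappa; apply/seteqP; split => x /=; rewrite mulrNz addrAC addrA.
have kappaL (V : set mR) : measurable V -> kappa V = (kappa (oc 0 1) * leb V)%E.
  apply: (@translation_invariant_measure _ kappa 1) => //.
    by move=> a b ab; have := finite_box ab ler01; rewrite -kappaE subr0 mulr1 mul1r.
  move=> eps eps0; have [q [p [d0 de]]] := alpha_approx eps0.
  set dd := _ - _ in d0 de; exists `|dd|; split; rewrite ?normr_gt0// => a b ab.
  have shift t a' b' : (fun x : mR => x + t : mR) @^-1` (oc a' b') = oc (a' - t) (b' - t) :> set mR.
    by apply/seteqP; split=> x /=; rewrite !ocE ltrBlDr lerBrDr.
  have [dd0|dd0] := ger0P dd.
    have := kappa_small q p (oc (a + dd) (b + dd)) (measurable_oc _ _).
    by rewrite shift !addrK => h; exact/esym/h.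
  by have := kappa_small q p (oc a b) (measurable_oc _ _); rewrite shift.
have fin : m (oc 0 1 `*` oc 0 1) \is a fin_num.
  rewrite ge0_fin_numE//; apply: (le_lt_trans (finite_box ler01 ler01)).
  by rewrite ltry.
move=> mE; have k0 : 0 <= fine (m (oc 0 1 `*` oc 0 1)) by rewrite fine_ge0.
rewrite -(fineK fin).
apply: (@measure_unique_oc2 _ m (mscale (NngNum k0) leb2)) => // a b c d ab cd.
  rewrite vert// kappaL; last exact: measurable_oc.
  rewrite kappaE /= /mscale /= leb2E; try exact: measurable_oc.
  by rewrite fineK// muleA.
by apply: (le_lt_trans (finite_box ab cd)); rewrite ltry.
Qed.

End rigidity.

(** * Sets where a sawtooth function wraps around *)

Section wrap.
Context {R : realType}.
Local Notation mR := (measurableTypeR R).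
Local Notation leb := (@lebesgue_measure R).

Definition fract (x : R) : R := x - (Num.floor x)%:~R.

Lemma fract_itv x : 0 <= fract x < 1.
Proof.
by have := floor_itv x; rewrite rmorphD/= /fract => /andP[*]; apply/andP; split; lra.
Qed.

Lemma fractDint x y : y \is a Num.int -> fract (x + y) = fract x.
Proof.
move=> yi; rewrite /fract floorDrz// rmorphD/=.
move: yi => /floorK yi; by rewrite yi; ring.
Qed.

(** The number of integers crossed when l x moves to l x + b, counted with
    sign. *)
Definition wrap (l : int) (b x : R) : int :=
  Num.floor (l%:~R * x + b) - Num.floor (l%:~R * x).

Lemma fract_wrap l a b x : l%:~R * a - b \is a Num.int ->
  fract (l%:~R * (x + a)) - fract (l%:~R * x) = b - (wrap l b x)%:~R.
Proof.
move=> h; rewrite (_ : l%:~R * (x + a) = l%:~R * x + b + (l%:~R * a - b)); last by ring.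
by rewrite fractDint// /fract /wrap rmorphB/=; ring.
Qed.

Lemma wrap_periodic l b x : wrap l b (x + 1) = wrap l b x.
Proof.
have li : l%:~R \is a @Num.int R by exact: intr_int.
by rewrite /wrap mulrDr mulr1 addrAC !(floorDrz _ li); ring.
Qed.

Lemma measurable_floor : measurable_fun setT ((fun x => (Num.floor x)%:~R) : mR -> mR).
Proof.
by apply: nondecreasing_measurable => // x y xy; rewrite ler_int le_floor.
Qed.

Lemma measurable_affine (a b : R) : measurable_fun setT ((fun x => a * x + b) : mR -> mR).
Proof.
apply: measurable_funD => //; apply: measurable_funM => //; exact: measurable_id.
Qed.

Lemma measurable_fract (a : R) : measurable_fun setT ((fun x => fract (a * x)) : mR -> mR).
Proof.
have h : measurable_fun setT ((fun x => a * x) : mR -> mR).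
  by apply: measurable_funM => //; exact: measurable_id.
by apply: measurable_funB => //; exact: (measurableT_comp measurable_floor h).
Qed.

Lemma measurable_wrap l b : measurable_fun setT ((fun x => (wrap l b x)%:~R) : mR -> mR).
Proof.
rewrite (_ : (fun x => _) = (fun x : mR => (Num.floor (l%:~R * x + b))%:~R
   - (Num.floor (l%:~R * x + 0))%:~R)); last first.
  by apply/funext => x; rewrite /wrap rmorphB/= addr0.
apply: measurable_funB; apply: (measurableT_comp measurable_floor); exact: measurable_affine.
Qed.

Definition wrap_set l b : set mR := [set x | wrap l b x != 0].

Lemma measurable_wrap_set l b : measurable (wrap_set l b).
Proof.
rewrite (_ : wrap_set l b = ~` ((fun x => (wrap l b x)%:~R) @^-1` [set (0 : R)])).
  apply: measurableC; rewrite -[X in measurable X]setTI.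
  exact: (measurable_wrap l b).
by apply/seteqP; split => x /=; rewrite /wrap_set/= -(intr_eq0 R) => /eqP.
Qed.

Definition window (N : nat) : set mR := [set x | `|x| <= N%:R].

Lemma measurable_window N : measurable (window N).
Proof.
rewrite (_ : window N = `[(- (N%:R)), (N%:R : R)]%classic).
  exact: measurable_itv.
by apply/seteqP; split => x; rewrite /window/= in_itv/= ler_norml.
Qed.

(** If the floor changes, then |l x - i| <= |b| for some integer i, and only
    O(|l| N) values of i are possible; each one confines x to an interval of
    length 2 |b| / |l|. *)
Lemma wrap_set_measure l b N : (l = 0 -> b = 0) ->
  (leb (wrap_set l b `&` window N) <= ((4 * N%:R + 6) * `|b|)%:E)%E.
Proof.
have [->|l0 _] := eqVneq l 0.
  move=> /(_ erefl) ->; rewrite (_ : wrap_set 0 0 = set0).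
    by rewrite set0I measure0 normr0 mulr0.
  by apply/seteqP; split => x //; rewrite /wrap_set/= /wrap mulr0z mul0r addr0 subrr eqxx.
pose M := (`|l| * N + 1)%N.
pose c (j : nat) : R := (j%:R - M%:R) / l%:~R.
pose r : R := `|b| / `|l%:~R|.
have lR0 : l%:~R != 0 :> R by rewrite intr_eq0.
have lRn : 0 < `|l%:~R| :> R by rewrite normr_gt0.
have lR1 : 1 <= `|l%:~R| :> R by rewrite -intr_norm (ler_int R 1); lia.
have r0 : 0 <= r by rewrite divr_ge0.
pose I (j : nat) : set mR := `[(c j - r), (c j + r)]%classic.
have mI j : measurable (I j) by exact: measurable_itv.
have lI j : leb (I j) = (2 * r)%:E.
  rewrite /I lebesgue_measure_itv/= lte_fin; case: ifPn => [_|].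
    by rewrite -EFinB; congr (_%:E); ring.
  by rewrite -leNgt => h; congr (_%:E); lra.
have sub : wrap_set l b `&` window N `<=` \big[setU/set0]_(j < M.*2.+1) I j.
  move=> x [wx Nx]; rewrite -bigcup_mkord.
  have key (z : int) : `|l%:~R * x - z%:~R| <= `|b| -> `|z| <= M%:Z ->
      (\bigcup_(j in `I_M.*2.+1) I j) x.
    move=> h1 h2; exists `|(z + M%:Z)%R|%N => /=; first by lia.
    have zE : (`|(z + M%:Z)%R|%N)%:R - M%:R = z%:~R :> R.
      rewrite natr_absz ger0_norm; last by lia.
      by rewrite rmorphD/= -[(M%:Z)%:~R]/(M%:R : R); ring.
    rewrite /I /= in_itv/= /c zE -ler_distl.
    rewrite /r ler_pdivlMr// -normrM mulrBl divfK// mulrC//.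
  have lx := floor_itv (l%:~R * x); set z := Num.floor _ in lx.
  have zM : `|z%:~R| <= (`|l| * N)%:R + 1 :> R.
    have : `|l%:~R * x| <= (`|l| * N)%:R.
      by rewrite normrM natrM natr_absz intr_norm ler_wpM2l.
    move: lx => /andP[h1 h2]; rewrite rmorphD/= in h2.
    by rewrite !ler_norml => /andP[h3 h4]; apply/andP; split; lra.
  have zM' : `|z| <= M%:Z by rewrite -(ler_int R) intr_norm -[M%:~R]/(M%:R) natrD.
  move: lx => /andP[h1 h2]; rewrite rmorphD/= in h2.
  have [b0|b0] := leP 0 b.
  - apply: (key (z + 1)).
      have : (z + 1)%:~R <= l%:~R * x + b.
        rewrite -floor_ge_int; move: wx; rewrite /wrap_set/= /wrap -/z subr_eq0 => wx.
        by rewrite lezD1 lt_neqAle eq_sym wx; apply: le_floor; rewrite lerDl.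
      rewrite rmorphD/= (ger0_norm b0) ler_norml => ?; apply/andP; split; lra.
    have : z%:~R < M%:R :> R.
      apply: le_lt_trans h1 _; apply: (@le_lt_trans _ _ `|l%:~R * x|); first exact: ler_norm.
      rewrite normrM /M natrD natrM natr_absz intr_norm ltr_pwDr//.
      by rewrite ler_wpM2l.
    by rewrite -[M%:R]/((M : int)%:~R) ltr_int => h; move: zM'; lia.
  - apply: (key z) => //.
    have : l%:~R * x + b < z%:~R.
      rewrite ltNge -floor_ge_int; apply/negP => h.
      move: wx; rewrite /wrap_set/= /wrap -/z subr_eq0 => /negP; apply.
      rewrite eq_le h andbT; apply: le_floor; lra.
    by rewrite (ltr0_norm b0) ler_norml => ?; apply/andP; split; lra.
apply: (@le_trans _ _ (leb (\big[setU/set0]_(j < M.*2.+1) I j))).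
  apply: le_measure => //; rewrite inE.
    by apply: measurableI; [exact: measurable_wrap_set|exact: measurable_window].
  by apply: bigsetU_measurable.
apply: (@le_trans _ _ (\sum_(j < M.*2.+1) leb (I j))%E).
  exact: (Boole_inequality leb).
under eq_bigr do rewrite lI.
rewrite sumEFin lee_fin sumr_const card_ord -[X in X <= _]mulr_natl /r.
rewrite (_ : M.*2.+1%:R * (2 * (`|b| / `|l%:~R|)) = M.*2.+1%:R * 2 / `|l%:~R| * `|b|); last by ring.
rewrite ler_wpM2r// ler_pdivrMr// -natr1 -mul2n natrM /M natrD natrM natr_absz intr_norm.
have : 0 <= (`|l%:~R| - 1) * 6 :> R by rewrite mulr_ge0// subr_ge0.
lra.
Qed.

End wrap.

(** * Series dominated by a geometric one *)

Section geometric.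
Context {R : realType}.

Lemma sum_pow2_le (c : R) n : 0 <= c -> \sum_(i < n) c * 2 ^- i <= 2 * c.
Proof.
move=> c0; suff -> : \sum_(i < n) c * 2 ^- i = 2 * c - 2 * c * 2 ^- n.
  by rewrite lerBlDr lerDl mulr_ge0// ?mulr_ge0// invr_ge0 exprn_ge0.
elim: n => [|n IH]; first by rewrite big_ord0 expr0 invr1 mulr1 subrr.
rewrite big_ord_recr/= IH exprS invfM [2 * c * (_ * _)]mulrACA divff ?pnatr_eq0//.
by ring.
Qed.

Lemma nneseries_pow2_le (u : nat -> \bar R) (c : R) : 0 <= c ->
  (forall i, 0 <= u i)%E -> (forall i, u i <= (c * 2 ^- i)%:E)%E ->
  (\sum_(i <oo) u i <= (2 * c)%:E)%E.
Proof.
move=> c0 u0 uc; apply: lime_le; first exact: is_cvg_nneseries.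
apply: nearW => n; rewrite big_mkord.
apply: (@le_trans _ _ (\sum_(i < n) (c * 2 ^- i)%:E)%E); first exact: lee_sum.
by rewrite sumEFin lee_fin sum_pow2_le.
Qed.

Lemma cvg_series_pow2 (a : nat -> R) (c : R) : 0 <= c ->
  (forall i, `|a i| <= c * 2 ^- i) -> cvgn (fun n => \sum_(i < n) a i).
Proof.
move=> c0 ac.
rewrite (_ : (fun n => _) = series a); last first.
  by apply/funext => n; rewrite /series/= big_mkord.
apply: normed_cvg.
apply: nondecreasing_is_cvgn; first by apply: nondecreasing_series => i _ _; exact: normr_ge0.
exists (2 * c) => _ [n _ <-]; rewrite /normed_series_of/= /series/= big_mkord.
apply: le_trans (sum_pow2_le n c0); apply: ler_sum => i _; exact: ac.
Qed.

End geometric.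

(** * The cocycle and its returns *)

Lemma amplitude_ge_pow2 k : (2 ^ (k + k) <= amplitude k)%N.
Proof. by case: k => // k; rewrite leq_exp2l// mulnS leq_add2l leq_pmulr. Qed.

Section cocycle.
Context {R : realType} (alpha : R) (e : nat -> R) (D : frequency_data alpha e).
Local Notation mR := (measurableTypeR R).
Local Notation leb := (@lebesgue_measure R).

Definition coboundary_term (k : nat) (x : R) : R :=
  (amplitude k)%:R * (theta D k - (wrap (freq D k) (theta D k) x)%:~R).

Lemma coboundary_termE k x : coboundary_term k x =
  (amplitude k)%:R * (fract ((freq D k)%:~R * (x + alpha)) - fract ((freq D k)%:~R * x)).
Proof. by rewrite (fract_wrap _ (thetaP D k)). Qed.

Definition partial_cocycle (n : nat) (x : R) : R := \sum_(k < n) coboundary_term k x.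

(** The points for which all but finitely many sawtooth increments are the
    constants K_k theta_k. *)
Definition regular : set mR :=
  ~` lim_sup_set (fun k => wrap_set (freq D k) (theta D k)).

Lemma regularP x : regular x <->
  exists M, forall k, (M <= k)%N -> wrap (freq D k) (theta D k) x = 0.
Proof.
split=> [|[M hM] /(_ M I)[k /= Mk] /=]; last by rewrite /wrap_set/= hM// eqxx.
rewrite /regular /lim_sup_set setC_bigcap => -[M _ /= h]; exists M => k Mk.
by apply/eqP/negPn/negP => wk; apply: h; exists k.
Qed.

Definition cocycle (x : R) : R :=
  if `[< regular x >] then limn (partial_cocycle ^~ x) else 0.

Lemma regular_periodic x : regular (x + 1) <-> regular x.
Proof.
by split=> /regularP[M h]; apply/regularP; exists M => k /h; rewrite wrap_periodic.
Qed.

Lemma coboundary_term_periodic k x : coboundary_term k (x + 1) = coboundary_term k x.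
Proof. by rewrite /coboundary_term wrap_periodic. Qed.

Lemma cocycle_periodic x : cocycle (x + 1) = cocycle x.
Proof.
rewrite /cocycle (_ : `[< regular (x + 1) >] = `[< regular x >]); last first.
  by apply: asbool_equiv_eq; exact: regular_periodic.
case: ifP => // _; congr (limn _); apply/funext => n.
by apply: eq_bigr => k _; exact: coboundary_term_periodic.
Qed.

Lemma pow2D_le (i k : nat) : 2 ^- (i + k) <= 2 ^- i :> R.
Proof.
by rewrite lef_pV2 ?posrE ?exprn_gt0// ler_weXn2l ?ler1n// leq_addr.
Qed.

Lemma amplitude_theta_small k : `|(amplitude k)%:R * theta D k| <= 1 * 2 ^- k.
Proof.
rewrite mul1r normrM ger0_norm//; exact: le_trans (theta_small D k) (pow2D_le _ _).
Qed.

Lemma cocycle_cvg x : regular x -> partial_cocycle n x @[n --> \oo] --> cocycle x.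
Proof.
move=> rx; rewrite /cocycle asboolT//.
have [M hM] := (regularP x).1 rx.
pose a k := (amplitude k)%:R * theta D k.
pose b k : R := (amplitude k)%:R * (wrap (freq D k) (theta D k) x)%:~R.
have ca : cvgn (fun n => \sum_(k < n) a k).
  by apply: (cvg_series_pow2 ler01) => k; exact: amplitude_theta_small.
have cb : cvgn (fun n => \sum_(k < n) b k).
  apply/cvg_ex; exists (\sum_(k < M) b k); apply: cvg_near_cst.
  near=> n; have Mn : (M <= n)%N by near: n; exact: nbhs_infty_ge.
  rewrite -!(big_mkord xpredT b) (big_cat_nat (leq0n M) Mn)/=.
  rewrite [X in _ + X]big_nat_cond [X in _ + X]big1 ?addr0// => k /andP[/andP[Mk _] _].
  by rewrite /b hM// mulr0.
suff -> : partial_cocycle ^~ x = (fun n => \sum_(k < n) a k - \sum_(k < n) b k).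
  exact: is_cvgB.
apply/funext => n; rewrite -sumrB; apply: eq_bigr => k _.
by rewrite /coboundary_term mulrBr.
Unshelve. all: by end_near. Qed.

Lemma measurable_regular : measurable regular.
Proof.
apply: measurableC; apply: bigcap_measurable => // n _.
by apply: bigcup_measurable => k _; exact: measurable_wrap_set.
Qed.

Lemma measurable_coboundary_term k : measurable_fun setT (coboundary_term k : mR -> mR).
Proof.
apply: measurable_funM => //; apply: measurable_funB => //; exact: measurable_wrap.
Qed.

Lemma measurable_cocycle : measurable_fun setT (cocycle : mR -> mR).
Proof.
pose h n : mR -> mR := fun x => partial_cocycle n x * \1_regular x.
apply: (@measurable_fun_cvg _ _ _ _ h).
  move=> n; apply: measurable_funM.
    by apply: measurable_sum => k; exact: measurable_coboundary_term.
  by apply: measurable_indic; exact: measurable_regular.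
move=> x _; rewrite /h indicE; have [rx|rx] := pselect (regular x).
  rewrite mem_set//; under eq_fun do rewrite mulr1.
  exact: cocycle_cvg.
rewrite memNset//; under eq_fun do rewrite mulr0.
by rewrite /cocycle asboolF//; exact: cvg_cst.
Qed.

Lemma null_window (A : set mR) : measurable A ->
  (forall N, leb (A `&` window N) = 0%E) -> leb A = 0%E.
Proof.
move=> mA h; have -> : A = \bigcup_N (A `&` window N).
  apply/seteqP; split=> [x Ax|x [N _ []]//].
  exists (Num.bound `|x|) => //; split => //; rewrite /window/= ltW//.
  exact: archi_boundP.
apply/eqP; rewrite -measure_le0.
have mw N : measurable (A `&` window N) by apply: measurableI => //; exact: measurable_window.
apply: (@le_trans _ _ (\sum_(N <oo) leb (A `&` window N))%E).
  by apply: measure_sigma_subadditive => //; exact: bigcup_measurable.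
by rewrite eseries0// => i _ _; exact: h.
Qed.

Lemma window_const_ge0 (N : nat) : 0 <= 4 * N%:R + 6 :> R.
Proof. by rewrite addr_ge0// mulr_ge0. Qed.

Lemma theta_le k : `|theta D k| <= 2 ^- k.
Proof.
apply: le_trans (pow2D_le k k); apply: le_trans (theta_small D k).
by rewrite ler_peMl// amplitude_ge1.
Qed.

(** Borel-Cantelli, on each bounded window. *)
Lemma regular_null : leb (~` regular) = 0%E.
Proof.
have mr := measurable_regular; rewrite /regular setCK.
apply: null_window; first by rewrite -[X in measurable X]setCK; exact: measurableC.
move=> N; pose F k := wrap_set (freq D k) (theta D k) `&` window N.
have mF k : measurable (F k).
  by apply: measurableI; [exact: measurable_wrap_set|exact: measurable_window].
apply/eqP; rewrite -measure_le0.
have <- : leb (lim_sup_set F) = 0%E.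
  apply: lim_sup_set_cvg0 => //.
  apply: (@le_lt_trans _ _ (2 * (4 * N%:R + 6))%:E); last by rewrite ltry.
  apply: nneseries_pow2_le => //.
  move=> k; have /le_trans := wrap_set_measure N (@theta0 _ _ _ D k); apply.
  by rewrite lee_fin ler_wpM2l// ?window_const_ge0// theta_le.
apply: le_measure; rewrite ?inE.
- apply: measurableI; last exact: measurable_window.
  by rewrite -[X in measurable X]setCK; exact: measurableC.
- by apply: bigcap_measurable => // n _; exact: bigcup_measurable.
- by move=> x [h Nx] n _; have [k nk Wk] := h n I; exists k.
Qed.

(** The sums telescope because each term is a coboundary. *)
Lemma partial_birkhoff M n x : \sum_(j < n) partial_cocycle M (x + j%:R * alpha) =
  \sum_(i < M) (amplitude i)%:R *
    (fract ((freq D i)%:~R * (x + n%:R * alpha)) - fract ((freq D i)%:~R * x)).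
Proof.
rewrite exchange_big/=; apply: eq_bigr => i _.
elim: n => [|n IH]; first by rewrite big_ord0 mul0r addr0 subrr mulr0.
by rewrite big_ord_recr/= IH coboundary_termE -natr1 mulrDl mul1r addrA; ring.
Qed.

(** The points where some sawtooth function wraps during the k-th return, or whose
    orbit leaves the set of convergence. *)
Definition exceptional (k : nat) : set mR :=
  \bigcup_i wrap_set (freq D i) (drift D i k) `|`
  \bigcup_j ((fun x : mR => x + j%:R * alpha : mR) @^-1` ~` regular).

(** Off the exceptional set the i-th sawtooth changes by exactly K_i drift_ik over
    the return time, and these numbers add up to about e_k. *)
Lemma birkhoff_drift k x : ~ exceptional k x ->
  `|birkhoff alpha cocycle (return_time D k) x - e k| <= 2 * 2 ^- k.
Proof.
move=> /not_orP[nW nR].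
have wE i : wrap (freq D i) (drift D i k) x = 0.
  by apply/eqP/negPn/negP => h; apply: nW; exists i.
have reg j : regular (x + j%:R * alpha).
  by apply: contrapT => h; apply: nR; exists j.
set n := return_time D k.
have cvg : \sum_(j < n) partial_cocycle M (x + j%:R * alpha) @[M --> \oo] -->
    birkhoff alpha cocycle n x.
  by apply: cvg_big => [|j _]; [exact: add_continuous|exact: cocycle_cvg].
have cvg' : `|\sum_(j < n) partial_cocycle M (x + j%:R * alpha) - e k| @[M --> \oo] -->
    `|birkhoff alpha cocycle n x - e k|.
  by apply: cvg_norm; apply: cvgB => //; exact: cvg_cst.
apply: (cvgr_to_le cvg'); near=> M.
have kM : (k < M)%N by near: M; exact: nbhs_infty_gt.
rewrite partial_birkhoff.
rewrite (eq_bigr (fun i : 'I_M => (amplitude i)%:R * drift D i k)); last first.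
  by move=> i _; rewrite (@fract_wrap _ _ _ (drift D i k)) ?wE ?subr0// mulrCA driftP.
have -> : e k = \sum_(i < M) (if (i == k :> nat) then e k else 0).
  rewrite (bigD1 (Ordinal kM))//= eqxx big1 ?addr0// => i ik.
  by case: eqP => // ikE; move: ik; rewrite -val_eqE/= ikE eqxx.
rewrite -sumrB; apply: (le_trans (ler_norm_sum _ _ _)).
apply: le_trans (sum_pow2_le M (_ : 0 <= 2 ^- k)); last by rewrite invr_ge0 exprn_ge0.
apply: ler_sum => i _; apply: (le_trans (drift_small D i k)).
by rewrite exprD invfM mulrC.
Unshelve. all: by end_near. Qed.

Lemma measurable_exceptional k : measurable (exceptional k).
Proof.
apply: measurableU; apply: bigcup_measurable => i _; first exact: measurable_wrap_set.
rewrite -[X in measurable X]setTI; apply: measurable_translation => //.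
by apply: measurableC; exact: measurable_regular.
Qed.

Lemma drift_le i k : `|drift D i k| <= (`|e k| + 1) * 2 ^- k * 2 ^- i.
Proof.
have A0 : 0 < (amplitude i)%:R :> R by rewrite ltr0n amplitude_gt0.
have := drift_small D i k; case: eqP => [->|_] h.
  rewrite -mulrA -invfM -exprD -ler_pdivrMr ?invr_gt0 ?exprn_gt0// invrK.
  have h1 : `|(amplitude k)%:R * drift D k k| <= `|e k| + 1.
    rewrite -[X in `|X|](subrK (e k)) (le_trans (ler_normD _ _))// addrC lerD2l.
    by apply: (le_trans h); rewrite invf_le1 ?exprn_gt0// exprn_ege1// ler1n.
  apply: le_trans h1; rewrite normrM ger0_norm// mulrC ler_wpM2r//.
  by rewrite -natrX ler_nat amplitude_ge_pow2.
rewrite subr0 in h; apply: (@le_trans _ _ (2 ^- (i + k))).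
  apply: le_trans h; rewrite normrM ger0_norm// ler_peMl//; exact: amplitude_ge1.
rewrite -mulrA -invfM -exprD addnC ler_peMl ?invr_ge0 ?exprn_ge0//.
by rewrite lerDr.
Qed.

Lemma exceptional_measure k N : (leb (exceptional k `&` window N) <=
  (2 * ((4 * N%:R + 6) * ((`|e k| + 1) * 2 ^- k)))%:E)%E.
Proof.
have mw := @measurable_window R N.
pose F i := wrap_set (freq D i) (drift D i k) `&` window N.
pose Z j := (fun x : mR => x + j%:R * alpha : mR) @^-1` (~` regular).
have mF i : measurable (F i).
  by apply: measurableI => //; exact: measurable_wrap_set.
have mZ j : measurable (Z j).
  rewrite -[X in measurable X]setTI; apply: measurable_translation => //.
  by apply: measurableC; exact: measurable_regular.
have Z0 : leb (\bigcup_j Z j) = 0%E.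
  apply/eqP; rewrite -measure_le0.
  apply: (@le_trans _ _ (\sum_(j <oo) leb (Z j))%E).
    by apply: measure_sigma_subadditive => //; exact: bigcup_measurable.
  rewrite eseries0// => j _ _; rewrite /Z lebesgue_measure_translation.
    exact: regular_null.
  by apply: measurableC; exact: measurable_regular.
have mFU : measurable (\bigcup_i F i) by exact: bigcup_measurable.
have mZU : measurable (\bigcup_j Z j) by exact: bigcup_measurable.
apply: (@le_trans _ _ (leb (\bigcup_i F i `|` \bigcup_j Z j))).
  apply: le_measure; rewrite ?inE.
  - by apply: measurableI => //; exact: measurable_exceptional.
  - exact: measurableU.
  - by move=> x [[[i _ Wi]|Zx] Nx]; [left; exists i|right].
apply: (le_trans (measureU2 _ mFU mZU)).
rewrite [X in (_ + X)%E](_ : _ = 0%E); last exact: Z0.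
rewrite adde0; apply: (@le_trans _ _ (\sum_(i <oo) leb (F i))%E).
  exact: measure_sigma_subadditive.
have c0 : 0 <= (`|e k| + 1) * 2 ^- k by rewrite mulr_ge0 ?addr_ge0// invr_ge0 exprn_ge0.
apply: nneseries_pow2_le => //.
move=> i; have /le_trans := wrap_set_measure N (@drift0 _ _ _ D i k); apply.
rewrite lee_fin -mulrA ler_wpM2l ?window_const_ge0//; exact: drift_le.
Qed.

Lemma pow2_small (c eps : R) : 0 < eps -> exists k0, forall k, (k0 <= k)%N -> c * 2 ^- k <= eps.
Proof.
move=> eps0; exists (Num.bound (`|c| / eps)) => k hk.
apply: (@le_trans _ _ (`|c| * 2 ^- k)).
  by rewrite ler_wpM2r ?ler_norm// invr_ge0 exprn_ge0.
rewrite ler_pdivrMr ?exprn_gt0// mulrC -ler_pdivrMr//.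
apply: le_trans (ltW (archi_boundP _)) _; first by rewrite divr_ge0// ltW.
by rewrite -natrX ler_nat (leq_trans hk)// ltnW// ltn_expl.
Qed.

Lemma cocycle_rigid (r : R) (N : nat) (eps : R) : 0 < eps ->
  (forall k0, exists2 k, (k0 <= k)%N & e k = r) ->
  exists (n : nat) (p : int) (Bad : set mR),
    [/\ `|n%:R * alpha - p%:~R| <= eps, measurable Bad, (leb Bad <= eps%:E)%E &
      forall x, `|x| <= N%:R -> ~ Bad x -> `|birkhoff alpha cocycle n x - r| <= eps].
Proof.
move=> eps0 er.
have [k0 hk0] := pow2_small (2 * ((4 * N%:R + 6) * (`|r| + 1)) + 2) eps0.
have [k /hk0 hk ek] := er k0.
have [p hp] := return_timeP D k.
have p0 : 0 <= 2 ^- k :> R by rewrite invr_ge0 exprn_ge0.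
have c0 : 0 <= 2 * ((4 * N%:R + 6) * (`|r| + 1)) * 2 ^- k.
  by rewrite mulr_ge0// mulr_ge0// mulr_ge0 ?window_const_ge0 ?addr_ge0.
exists (return_time D k), p, (exceptional k `&` window N); split.
- by apply: (le_trans hp); apply: le_trans hk; lra.
- by apply: measurableI; [exact: measurable_exceptional|exact: measurable_window].
- apply: (le_trans (exceptional_measure k N)); rewrite lee_fin ek.
  by apply: le_trans hk; rewrite mulrDl !mulrA; lra.
- move=> x Nx nB; rewrite -ek; apply: (le_trans (@birkhoff_drift k x _)).
    by move=> h; apply: nB.
  by apply: le_trans hk; lra.
Qed.

End cocycle.

Definition enum_rat (R : realType) (k : nat) : R :=
  if @unpickle (rat * nat)%type k is Some (r, _) then ratr r else 0.

(** Each rational is paired with infinitely many natural numbers, and the codes of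
    these pairs are unbounded. *)
Lemma enum_rat_often (R : realType) (r : rat) k0 :
  exists2 k, (k0 <= k)%N & enum_rat R k = ratr r.
Proof.
suff [i hi] : exists i : nat, (k0 <= @pickle (rat * nat)%type (r, i))%N.
  by exists (@pickle (rat * nat)%type (r, i)) => //; rewrite /enum_rat pickleK.
apply: contrapT => h.
have lt_k0 i : (@pickle (rat * nat)%type (r, i) < k0)%N.
  by rewrite ltnNge; apply/negP => hi; apply: h; exists i.
have U : uniq [seq @pickle (rat * nat)%type (r, i) | i <- iota 0 k0.+1].
  rewrite map_inj_uniq ?iota_uniq// => i j ij.
  by have [] := pcan_inj pickleK ij.
have S : {subset [seq @pickle (rat * nat)%type (r, i) | i <- iota 0 k0.+1] <= iota 0 k0}.
  by move=> _ /mapP[i _ ->]; rewrite mem_iota/= add0n lt_k0.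
by have := uniq_leq_size U S; rewrite size_map !size_iota ltnn.
Qed.

(** * From the line to the circle *)

Section descend.
Context {R : realType}.
Local Notation mR := (measurableTypeR R).

Lemma periodic_int T (f : R -> T) : (forall x, f (x + 1) = f x) ->
  forall (p : int) x, f (x + p%:~R) = f x.
Proof.
move=> f1; have nat_case (n : nat) x : f (x + n%:R) = f x.
  by elim: n => [|n IH]; rewrite ?addr0// -natr1 addrA f1.
move=> [n|n] x; first exact: nat_case.
by rewrite -(nat_case n.+1 (x + _)) NegzE mulrNz subrK.
Qed.

Lemma periodic_descend T (f : R -> T) : (forall x, f (x + 1) = f x) ->
  forall x, f (repr_circle (proj_circle x)) = f x.
Proof.
move=> f1 x; have /eq_proj_circle/intrP[p hp] :
    proj_circle (repr_circle (proj_circle x)) = proj_circle x by rewrite repr_circleK.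
by rewrite -[X in f X](subrK x) hp addrC periodic_int.
Qed.

Lemma proj_circleD1 (x : R) : proj_circle (x + 1) = proj_circle x.
Proof. by apply/eq_proj_circle; rewrite addrAC subrr add0r rpred1. Qed.

Lemma circle_translation_proj (alpha x : R) :
  circle_translation alpha (proj_circle x) = proj_circle (x + alpha).
Proof. by rewrite /circle_translation raddfD. Qed.

Lemma measurable_descend (f : mR -> mR) : (forall x, f (x + 1) = f x) ->
  measurable_fun setT f ->
  measurable_fun setT ((fun t => f (repr_circle t)) : circle R -> mR).
Proof.
move=> f1 mf _ B mB; rewrite setTI.
change (measurable (@proj_circle R @^-1` ((fun t => f (repr_circle t)) @^-1` B))).
rewrite (_ : _ @^-1` _ = f @^-1` B); first by rewrite -[X in measurable X]setTI; exact: mf.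
by apply/seteqP; split => x /=; rewrite periodic_descend.
Qed.

End descend.

Section cylinder.
Context {R : realType}.
Local Notation mR := (measurableTypeR R).
Local Notation leb := (@lebesgue_measure R).
Local Notation leb2 := (leb \x leb)%E.
Local Notation mu := (cylinder_measure R).

Definition cover (z : mR * mR) : circle R * mR := (proj_circle z.1, z.2).

Lemma measurable_cover : measurable_fun setT cover.
Proof.
apply/measurable_fun_pairP; split => /=; last exact: measurable_snd.
exact: (measurableT_comp (@measurable_proj_circle R) measurable_fst).
Qed.

Lemma measurable_cover_preimage A : measurable A -> measurable (cover @^-1` A).
Proof. by move=> mA; rewrite -[X in measurable X]setTI; exact: measurable_cover. Qed.

Let strip : set (mR * mR) := (`[0, 1[%classic : set R) `*` setT.

Let mstrip : measurable strip.
Proof. by apply: measurableX => //; exact: measurable_itv. Qed.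

Lemma cylinder_measureE A : measurable A -> mu A = leb2 (cover @^-1` A `&` strip).
Proof.
move=> mA; have mc := measurable_cover.
pose nu := pushforward (mrestr leb2 mstrip) cover.
apply: (@product_measure_unique _ _ _ _ R (@circle_measure R) leb nu) => // V H mV mH.
rewrite /nu /= /pushforward /mrestr.
rewrite (_ : _ `&` _ = (@proj_circle R @^-1` V `&` (`[0, 1[%classic : set R)) `*` H).
  rewrite product_measure1E//; apply: measurableI; first exact: mV.
  exact: measurable_itv.
by apply/seteqP; split=> -[x y]; rewrite /strip /cover /=; tauto.
Qed.

Lemma leb2_skew (t : R) (S : mR -> mR) (E : set (mR * mR)) :
  measurable_fun setT S -> measurable E ->
  leb2 ((fun z : mR * mR => (z.1 + t, z.2 + S z.1) : mR * mR) @^-1` E) = leb2 E.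
Proof.
move=> mS mE; have mt := @measurable_translation R t.
have tp A : measurable A -> leb ((fun x : mR => x + t : mR) @^-1` A) = leb A.
  by move=> mA; rewrite lebesgue_measure_translation.
rewrite -[RHS](base_measure_preserving mt tp mE).
have mid : measurable_fun setT (cst 0 : mR -> mR) by exact: measurable_cst.
have mbE : measurable ((fun z : mR * mR => (z.1 + t, z.2) : mR * mR) @^-1` E).
  rewrite (_ : (fun z => _) = (fun z : mR * mR => (z.1 + t, z.2 + cst 0 z.1) : mR * mR)).
    by rewrite -[X in measurable X]setTI; apply: (measurable_skew mt mid).
  by apply/funext => -[x y] /=; rewrite addr0.
by rewrite -[RHS](skew_measure_preserving _ mS mbE).
Qed.

Lemma measure_eq_mod_null d (T : measurableType d) (m : {measure set T -> \bar R}) (X Y Z : set T) :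
  measurable X -> measurable Y -> measurable Z -> m Z = 0%E ->
  X `<=` Y `|` Z -> Y `<=` X `|` Z -> m X = m Y.
Proof.
move=> mX mY mZ Z0 XY YX; apply/eqP; rewrite eq_le; apply/andP.
have h (U V : set T) : measurable U -> measurable V -> U `<=` V `|` Z -> (m U <= m V)%E.
  move=> mU mV UV; apply: (@le_trans _ _ (m (V `|` Z))).
    by apply: le_measure => //; rewrite inE//; exact: measurableU.
  by apply: (le_trans (measureU2 _ mV mZ)); rewrite [X in (_ + X)%E]Z0 adde0.
by split; exact: h.
Qed.

(** The preimage is covered by the integer translates of its part over the
    fundamental domain, all of which are null. *)
Lemma cover_null B : measurable B -> mu B = 0%E -> leb2 (cover @^-1` B) = 0%E.
Proof.
move=> mB B0; have mcB := measurable_cover_preimage mB.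
pose piece (p : int) := (fun z : mR * mR => (z.1 + p%:~R, z.2 + cst 0 z.1) : mR * mR)
  @^-1` (cover @^-1` B `&` strip).
have mI := measurableI _ _ mcB mstrip.
have m0 : measurable_fun setT (cst 0 : mR -> mR) by exact: measurable_cst.
have mp p : measurable (piece p).
  rewrite -[X in measurable X]setTI.
  by apply: (measurable_skew (measurable_translation p%:~R) m0).
have p0 p : leb2 (piece p) = 0%E.
  by rewrite /piece leb2_skew// -cylinder_measureE.
pose U n := piece n%:Z `|` piece (- n%:Z).
have mU n : measurable (U n) by exact: measurableU.
apply/eqP; rewrite -measure_le0.
apply: (@le_trans _ _ (\sum_(n <oo) leb2 (U n))%E).
  apply: measure_sigma_subadditive => // -[x y] Bxy.
  pose p : int := - Num.floor x.
  have hp : piece p (x, y).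
    split; rewrite /cover/= addr0.
      suff -> : proj_circle (x + p%:~R) = proj_circle x by [].
      by apply/eq_proj_circle; rewrite addrAC subrr add0r rpred_int.
    split=> //=; rewrite in_itv/= /p mulrNz.
    have := floor_itv x; rewrite rmorphD/= => /andP[h1 h2]; apply/andP; split; lra.
  exists `|p|%N => //; rewrite /U.
  have [pge|plt] := leP 0 p; first by left; rewrite gez0_abs.
  by right; rewrite ltz0_abs// opprK.
rewrite eseries0// => n _ _.
apply/eqP; rewrite -measure_le0; apply: (le_trans (measureU2 _ (mp _) (mp _))).
by rewrite [X in (X + _)%E](p0 n%:Z) [X in (_ + X)%E](p0 (- n%:Z)) adde0.
Qed.

(** Let m be the restriction of Lebesgue measure to the lift of an invariant set.
    It is invariant, hence k times Lebesgue measure, and it vanishes on the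
    complement of the lift: either k = 0 or this complement is null. *)
Theorem rigid_ergodic (alpha : R) (phi : mR -> mR) :
  measurable_fun setT phi -> (forall x, phi (x + 1) = phi x) ->
  (forall e : R, 0 < e -> exists (q : nat) (p : int),
    let d := q%:R * alpha - p%:~R in d != 0 /\ `|d| < e) ->
  (forall (r : rat) (N : nat) (eps : R), 0 < eps ->
    exists (n : nat) (p : int) (Bad : set mR),
    [/\ `|n%:R * alpha - p%:~R| <= eps, measurable Bad, (leb Bad <= eps%:E)%E &
      forall x, `|x| <= N%:R -> ~ Bad x -> `|birkhoff alpha phi n x - ratr r| <= eps]) ->
  ergodic mu (cylinder_flow alpha (fun t => phi (repr_circle t))).
Proof.
move=> mphi phi1 approx rigid A mA [B [mB B0 subB]].
pose A' := cover @^-1` A.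
have mA' : measurable A' by exact: measurable_cover_preimage.
have B'0 := cover_null mB B0; have mB' := measurable_cover_preimage mB.
set B' := cover @^-1` B in B'0 mB'.
pose flow (z : mR * mR) : mR * mR := (z.1 + alpha, z.2 + phi z.1).
have mflow : measurable_fun setT flow.
  exact: (measurable_skew (measurable_translation alpha) mphi).
have mfl E : measurable E -> measurable (flow @^-1` E).
  by move=> mE; rewrite -[X in measurable X]setTI; exact: mflow.
have flowA z : ((flow @^-1` A') z /\ A' z) \/ (~ (flow @^-1` A') z /\ ~ A' z) \/ B' z.
  have [Bz|nB] := pselect (B' z); first by right; right.
  have h : ~ ((cylinder_flow alpha (fun t => phi (repr_circle t))) @^-1` A `+` A) (cover z).
    by move=> h; apply: nB; exact: subB.
  have E : (flow @^-1` A') z = ((cylinder_flow alpha (fun t => phi (repr_circle t)))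
      @^-1` A) (cover z).
    by rewrite /A' /flow /cover /= /cylinder_flow /= circle_translation_proj periodic_descend.
  move: h; rewrite E => h.
  have [a|na] := pselect (A (cover z));
    have [b|nb] := pselect
      (((cylinder_flow alpha (fun t => phi (repr_circle t))) @^-1` A) (cover z));
    [by left| | |by right; left].
  - by exfalso; apply: h; right.
  - by exfalso; apply: h; left.
pose m := mrestr leb2 mA'.
have mE E : m E = leb2 (E `&` A') by [].
have k1 := @rigid_measure_unique R alpha phi mphi approx rigid m.
have {}k1 : forall E, measurable E -> m E = (m (oc 0%R 1%R `*` oc 0%R 1%R) * leb2 E)%E.
  apply: k1.
  - move=> E mE'; rewrite [leLHS]mE; apply: le_measure; rewrite ?inE//.
    exact: measurableI.
  - move=> E mE'; rewrite [LHS]mE [RHS]mE.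
    rewrite -[RHS](leb2_skew alpha mphi (measurableI _ _ mE' mA')).
    apply: (measure_eq_mod_null _ _ mB' B'0).
    + by apply: measurableI => //; exact: mfl.
    + exact: (mfl _ (measurableI _ _ mE' mA')).
    + move=> z [Ez Az]; have [[h _]|[[_ nA]|Bz]] := flowA z; [by left|by []|by right].
    + move=> z [Ez Az]; have [[_ h]|[[nA _]|Bz]] := flowA z; [by left|by []|by right].
  - move=> E mE'; rewrite [LHS]mE [RHS]mE.
    have m0 : measurable_fun setT (cst 0 : mR -> mR) by exact: measurable_cst.
    rewrite -[RHS](leb2_skew 1 m0 (measurableI _ _ mE' mA')).
    congr (leb2 _); apply/seteqP; split => -[x y]; rewrite /A' /cover /=;
      by rewrite proj_circleD1 !addr0.
set k := m (oc _ _ `*` _) in k1.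
have kA : k = 0%E \/ leb2 (~` A') = 0%E.
  have := k1 (~` A') (measurableC mA'); rewrite mE setICl measure0 => /esym/eqP.
  by rewrite mule_eq0 => /orP[/eqP|/eqP]; [left|right].
have conc C : measurable C -> leb2 (cover @^-1` C) = 0%E -> mu C = 0%E.
  move=> mC C0; rewrite cylinder_measureE//; apply/eqP; rewrite -measure_le0 -C0.
  apply: le_measure; rewrite ?inE//; last exact: measurable_cover_preimage.
  by apply: measurableI => //; exact: measurable_cover_preimage.
case: kA => [k0|A0]; [left|right].
  by apply: conc => //; have := k1 A' mA'; rewrite k0 mul0e mE setIid.
by apply: conc; [exact: measurableC|rewrite preimage_setC].
Qed.

End cylinder.

(** * Numbers with digits 0 and 1 in the base of the amplitudes *)

Section digits.
Context {R : realType} (b : nat -> bool).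

(** The integer part of K_k s, where s = sum_j b_j / K_(j+1). *)
Fixpoint digit_sum (k : nat) : nat :=
  if k is j.+1 then (2 ^ (2 * j.+1) * digit_sum j + b j)%N else 0%N.

Definition quot_seq (k : nat) : R := (digit_sum k)%:R / (amplitude k)%:R.

Lemma amplitudeS k : amplitude k.+1 = (2 ^ (2 * k.+1) * amplitude k)%N.
Proof. by rewrite /amplitude -expnD; congr (2 ^ _)%N; lia. Qed.

Let amplitudeR_gt0 k : 0 < (amplitude k)%:R :> R.
Proof. by rewrite ltr0n amplitude_gt0. Qed.

Let amplitudeV_ge0 k : 0 <= (amplitude k)%:R^-1 :> R.
Proof. by rewrite invr_ge0. Qed.

Lemma quot_seqS k : quot_seq k.+1 = quot_seq k + (b k)%:R / (amplitude k.+1)%:R.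
Proof.
rewrite /quot_seq [digit_sum _]/= natrD mulrDl; congr (_ + _).
by rewrite amplitudeS !natrM -mulf_div divff ?mul1r// pnatr_eq0 expn_eq0.
Qed.

Lemma amplitudeV_half k : 2 / (amplitude k.+1)%:R <= (amplitude k)%:R^-1 :> R.
Proof.
rewrite amplitudeS natrM ler_pdivrMr; last by rewrite mulr_gt0// ltr0n expn_gt0.
rewrite mulrA mulrAC mulVf ?mul1r ?gt_eqF// ler_nat.
by rewrite -[2%N]expn1 leq_exp2l//; lia.
Qed.

Lemma quot_seq_homo : nondecreasing_seq quot_seq.
Proof.
by apply/nondecreasing_seqP => k; rewrite quot_seqS lerDl mulr_ge0.
Qed.

(** The upper bounds of the tails decrease, because each amplitude is at least
    twice the previous one. *)
Lemma quot_seq_upper k n : (k <= n)%N ->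
  quot_seq n + 2 / (amplitude n.+1)%:R <= quot_seq k + 2 / (amplitude k.+1)%:R.
Proof.
elim: n => [|n IH]; first by rewrite leqn0 => /eqP ->.
rewrite leq_eqVlt => /orP[/eqP->//|/IH]; apply: le_trans.
rewrite quot_seqS -addrA lerD2l.
have := amplitudeV_half n.+1; have : (b n)%:R / (amplitude n.+1)%:R <= (amplitude n.+1)%:R^-1 :> R.
  by rewrite ler_piMl// lern1; case: (b n).
lra.
Qed.

Lemma quot_seq_le k n : quot_seq n <= quot_seq k + 2 / (amplitude k.+1)%:R.
Proof.
have [kn|/ltnW nk] := leqP k n.
  apply: le_trans (quot_seq_upper kn); rewrite lerDl mulr_ge0//.
by apply: (le_trans (quot_seq_homo nk)); rewrite lerDl mulr_ge0.
Qed.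

Definition digit_limit : R := limn quot_seq.

Lemma quot_seq_cvg : cvgn quot_seq.
Proof.
apply: nondecreasing_is_cvgn; first exact: quot_seq_homo.
exists (quot_seq 0 + 2 / (amplitude 1)%:R) => _ [n _ <-]; exact: quot_seq_le.
Qed.

Definition digit_error (k : nat) : R := (amplitude k)%:R * digit_limit - (digit_sum k)%:R.

Lemma digit_error_itv k : 0 <= digit_error k <= 2^-1 * 2 ^- k.
Proof.
have l1 : quot_seq k <= digit_limit.
  by apply: nondecreasing_cvgn_le; [exact: quot_seq_homo|exact: quot_seq_cvg].
have l2 : digit_limit <= quot_seq k + 2 / (amplitude k.+1)%:R.
  apply: limr_le; first exact: quot_seq_cvg.
  by apply: nearW => n; exact: quot_seq_le.
have qE : (amplitude k)%:R * quot_seq k = (digit_sum k)%:R by rewrite mulrC divfK// gt_eqF.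
rewrite /digit_error -qE -mulrBr; apply/andP; split.
  by rewrite mulr_ge0// subr_ge0.
apply: (@le_trans _ _ ((amplitude k)%:R * (2 / (amplitude k.+1)%:R))).
  by rewrite ler_wpM2l// lerBlDl.
rewrite amplitudeS natrM invfM mulrCA [X in 2 * X]mulrC divfK ?gt_eqF// natrX.
rewrite -invfM -exprS ler_pdivrMr ?exprn_gt0// mulrC ler_pdivlMr ?exprn_gt0//.
by rewrite -exprS ler_weXn2l ?ler1n//; lia.
Qed.

Lemma digit_sum_floor k : Num.floor ((amplitude k)%:R * digit_limit) = digit_sum k :> int.
Proof.
apply: floor_def; rewrite rmorphD/= -[((digit_sum k)%:Z)%:~R]/((digit_sum k)%:R : R).
have := digit_error_itv k; rewrite /digit_error => /andP[h1 h2].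
have : 2 ^- k <= 1 :> R by rewrite invf_le1 ?exprn_gt0// exprn_ege1// ler1n.
move=> h3; apply/andP; split; lra.
Qed.

Lemma digit_sum_le k : (digit_sum k)%:R <= (amplitude k)%:R :> R.
Proof.
rewrite -[leRHS]mul1r -ler_pdivrMr//; apply: (le_trans (quot_seq_le 0 k)).
by rewrite /quot_seq mul0r add0r ler_pdivrMr// mul1r ler_nat.
Qed.

End digits.

(** The integer parts of K_k s recover the digits. *)
Lemma digit_limit_inj (R : realType) : injective (@digit_limit R).
Proof.
move=> b b' bb'; have dd k : digit_sum b k = digit_sum b' k.
  by apply/eqP; rewrite -eqz_nat -!(digit_sum_floor (R := R)) bb'.
apply/funext => k; have := dd k.+1; rewrite /= dd => /addnI.
by case: (b k) (b' k) => -[].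
Qed.

(** * The multiplicative transfer equation *)

Section eigenfunction.
Context {R : realType} (alpha : R) (e : nat -> R) (D : frequency_data alpha e).
Context (b : nat -> bool).
Local Notation mR := (measurableTypeR R).
Local Notation s := (@digit_limit R b).

Definition transfer_sum (n : nat) (x : R) : R :=
  \sum_(k < n) digit_error b k * fract ((freq D k)%:~R * x).

Definition transfer (x : R) : R := limn (transfer_sum ^~ x).

Definition angle_sum (n : nat) : R := \sum_(k < n) (digit_sum b k)%:R * theta D k.

Definition angle : R := limn angle_sum.

Lemma transfer_sum_cvg x : transfer_sum n x @[n --> \oo] --> transfer x.
Proof.
suff : cvgn (transfer_sum ^~ x) by [].
apply: (@cvg_series_pow2 R (fun k => digit_error b k * fract ((freq D k)%:~R * x)) 1 ler01) => k.
have /andP[f0 f1] := fract_itv ((freq D k)%:~R * x).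
have /andP[d0 d1] := digit_error_itv (R := R) b k.
have p0 : 0 <= 2 ^- k :> R by rewrite invr_ge0 exprn_ge0.
rewrite normrM !ger0_norm// mul1r; apply: (@le_trans _ _ (digit_error b k)).
  by rewrite ler_piMr// ltW.
by apply: (le_trans d1); lra.
Qed.

Lemma angle_sum_cvg : angle_sum n @[n --> \oo] --> angle.
Proof.
suff : cvgn angle_sum by [].
apply: (@cvg_series_pow2 R (fun k => (digit_sum b k)%:R * theta D k) 1 ler01) => k.
rewrite mul1r normrM ger0_norm//.
apply: le_trans (pow2D_le k k); apply: le_trans (theta_small D k).
by rewrite ler_wpM2r// digit_sum_le.
Qed.

Lemma measurable_transfer : measurable_fun setT (transfer : mR -> mR).
Proof.
apply: (@measurable_fun_cvg _ _ _ _ (transfer_sum : nat -> mR -> mR)).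
  move=> n; apply: measurable_sum => k; apply: measurable_funM => //.
  exact: measurable_fract.
by move=> x _; exact: transfer_sum_cvg.
Qed.

Lemma transfer_periodic x : transfer (x + 1) = transfer x.
Proof.
congr (limn _); apply/funext => n; apply: eq_bigr => k _.
by rewrite [_ * (x + 1)]mulrDr mulr1 fractDint// intr_int.
Qed.

(** Split K_k s into its integer part m_k and the error d_k in each term of
    s phi.  The error part telescopes into the transfer function; the other part is
    m_k theta_k minus the integer m_k wrap_k, which vanishes for large k. *)
Lemma transfer_equation x : regular D x -> exists z : int,
  s * cocycle D x = transfer (x + alpha) - transfer x + angle - z%:~R.
Proof.
move=> rx; have [M hM] := (regularP D x).1 rx.
exists (\sum_(k < M) (digit_sum b k)%:Z * wrap (freq D k) (theta D k) x).
set Z := (\sum_(k < M) _)%:~R.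
have step n : (M <= n)%N -> s * partial_cocycle D n x =
    transfer_sum n (x + alpha) - transfer_sum n x + angle_sum n - Z.
  move=> Mn; have -> : Z =
      \sum_(k < n) (digit_sum b k)%:R * (wrap (freq D k) (theta D k) x)%:~R :> R.
    rewrite /Z rmorph_sum/= -[RHS](big_mkord xpredT (fun k =>
      (digit_sum b k)%:R * (wrap (freq D k) (theta D k) x)%:~R)).
    rewrite (big_cat_nat (leq0n M) Mn)/= [X in _ + X]big_nat_cond [X in _ + X]big1 ?addr0.
      by rewrite big_mkord; apply: eq_bigr => k _; rewrite rmorphM.
    by move=> k /andP[/andP[Mk _] _]; rewrite hM// mulr0.
  rewrite /partial_cocycle mulr_sumr -sumrB -big_split/= -sumrB; apply: eq_bigr => k _.
  have sE : s * (amplitude k)%:R = digit_error b k + (digit_sum b k)%:R.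
    by rewrite /digit_error subrK mulrC.
  have cE := fract_wrap x (thetaP D k).
  by rewrite coboundary_termE mulrA sE mulrDl mulrBr [in X in _ + X]cE; ring.
have c1 : s * partial_cocycle D n x @[n --> \oo] --> s * cocycle D x.
  by apply: cvgMr; exact: cocycle_cvg.
have c2 : transfer_sum n (x + alpha) - transfer_sum n x + angle_sum n - Z @[n --> \oo] -->
    transfer (x + alpha) - transfer x + angle - Z.
  apply: cvgB; last exact: cvg_cst.
  apply: cvgD; last exact: angle_sum_cvg.
  by apply: cvgB; exact: transfer_sum_cvg.
have c3 : s * partial_cocycle D n x @[n --> \oo] -->
    transfer (x + alpha) - transfer x + angle - Z.
  apply: cvg_trans c2; apply: near_eq_cvg.
  by near=> n; rewrite step//; near: n; exact: nbhs_infty_ge.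
exact: (cvg_unique _ c1 c3).
Unshelve. all: by end_near. Qed.

End eigenfunction.

(** * Eigenfunctions and ergodicity *)

Section circle_exponential.
Context {R : realType}.
Local Notation mR := (measurableTypeR R).

Lemma circle_expD (s t : circle R) : circle_exp (s + t) = circle_exp s * circle_exp t.
Proof.
rewrite -(repr_circleK s) -(repr_circleK t) -raddfD !circle_exp_proj mulrDr.
by rewrite cosD sinD /=; apply/eqP; rewrite eq_complex/= [X in _ && (_ == X)]addrC !eqxx.
Qed.

Lemma normc_circle_exp (t : circle R) : Normc.normc (circle_exp t) = 1.
Proof. by rewrite /circle_exp /= cos2Dsin2 sqrtr1. Qed.

Lemma circle_exp_neq0 (t : circle R) : circle_exp t != 0.
Proof.
apply/eqP => h; have := normc_circle_exp t; rewrite h /=.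
by rewrite expr0n/= addr0 sqrtr0 => /eqP; rewrite eq_sym oner_eq0.
Qed.

End circle_exponential.

Section spectrum.
Context {R : realType} (alpha : R) (e : nat -> R) (D : frequency_data alpha e).
Local Notation mR := (measurableTypeR R).
Local Notation leb := (@lebesgue_measure R).
Local Notation mu := (cylinder_measure R).

Definition circle_cocycle (t : circle R) : R := cocycle D (repr_circle t).

Local Notation flow := (cylinder_flow alpha circle_cocycle).

Lemma measurable_circle_cocycle : measurable_fun setT circle_cocycle.
Proof. exact: (measurable_descend (cocycle_periodic D) (measurable_cocycle D)). Qed.

Definition circle_regular : set (circle R) := [set t | regular D (repr_circle t)].

Lemma ae_circle_regular : \forall z \ae mu, circle_regular z.1.
Proof.
have rE x : regular D (repr_circle (proj_circle x)) = regular D x.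
  by apply: periodic_descend => y; apply/propext; exact: regular_periodic.
have cE : @proj_circle R @^-1` circle_regular = regular D.
  by apply/seteqP; split => x; rewrite /circle_regular/= rE.
have mC : measurable (~` circle_regular).
  by apply: measurableC; rewrite /measurable/= /circle_measurable/= cE; exact: measurable_regular.
exists ((~` circle_regular) `*` setT); split.
- exact: measurableX.
- have mr : measurable (~` regular D) by apply: measurableC; exact: measurable_regular.
  have c0 : @circle_measure R (~` circle_regular) = 0%E.
    apply/eqP; rewrite -measure_le0 -(regular_null D).
    apply: (@le_trans _ _ (leb (~` regular D `&` (`[0%R, 1%R[%classic : set R)))).
      by rewrite -[in leRHS]cE; exact: lexx.
    apply: le_measure; rewrite ?inE//.
    by apply: measurableI => //; exact: measurable_itv.
  by rewrite /= product_measure1E//= c0 mul0e.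
- by move=> [t y] /= h; split.
Qed.

Lemma cylinder_setT_neq0 : mu setT != 0%E.
Proof.
apply/eqP => h; have : (mu (setT `*` oc (0:R) 1) <= mu setT)%E.
  apply: le_measure; rewrite ?inE//; apply: measurableX => //; exact: measurable_oc.
rewrite h /= product_measure1E//=; last exact: measurable_oc.
rewrite lebesgue_oc// (probability_setT (@circle_measure R)) mul1e subr0.
by rewrite lee_fin ler10.
Qed.

Section one_sequence.
Context (b : nat -> bool).
Local Notation s := (@digit_limit R b).

Definition circle_transfer (t : circle R) : R := transfer D b (repr_circle t).

Lemma measurable_circle_transfer : measurable_fun setT (circle_transfer : circle R -> mR).
Proof. exact: (measurable_descend (transfer_periodic D b) (measurable_transfer D b)). Qed.

Lemma circle_transfer_equation (t : circle R) : circle_regular t -> exists z : int,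
  s * circle_cocycle t =
  circle_transfer (circle_translation alpha t) - circle_transfer t + angle D b - z%:~R.
Proof.
move=> /transfer_equation h; have [z hz] := h b; exists z.
rewrite /circle_cocycle hz /circle_transfer -[in circle_translation _ _](repr_circleK t).
by rewrite circle_translation_proj (periodic_descend (transfer_periodic D b)).
Qed.

Definition phase (z : circle R * mR) : R := s * z.2 - circle_transfer z.1.

Lemma measurable_phase : measurable_fun setT (phase : circle R * mR -> mR).
Proof.
apply: measurable_funB.
  by apply: measurable_funM => //; exact: measurable_snd.
exact: (measurableT_comp measurable_circle_transfer measurable_fst).
Qed.

Lemma phase_flow z : circle_regular z.1 -> exists n : int,
  phase (flow z) = phase z + angle D b - n%:~R.
Proof.
move=> /circle_transfer_equation[n hn]; exists n.
by rewrite /phase /cylinder_flow/= mulrDr hn; ring.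
Qed.

Lemma angle_eigenvalue : eigenvalues mu flow (proj_circle (angle D b)).
Proof.
exists (fun z => circle_exp (proj_circle (phase z))); split.
- have mlin : measurable_fun setT ((fun z => 2 * pi * phase z) : circle R * mR -> mR).
    by apply: measurable_funM => //; exact: measurable_phase.
  split.
  + rewrite (_ : (fun z => _) = (fun z => cos (2 * pi * phase z))); last first.
      by apply/funext => z; rewrite circle_exp_proj.
    apply: (measurableT_comp _ mlin); apply: continuous_measurable_fun.
    exact: continuous_cos.
  + rewrite (_ : (fun z => _) = (fun z => sin (2 * pi * phase z))); last first.
      by apply/funext => z; rewrite circle_exp_proj.
    apply: (measurableT_comp _ mlin); apply: continuous_measurable_fun.
    exact: continuous_sin.
  + rewrite (_ : (fun z => _) = cst 1%E); last first.
      by apply/funext => z; rewrite normc_circle_exp.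
    by rewrite ess_sup_cst ?ltry// lt0e cylinder_setT_neq0/=.
- move=> [B [mB B0 sub]].
  have BT : B = setT.
    by apply/seteqP; split=> // z _; apply: sub => /= /eqP; rewrite (negbTE (circle_exp_neq0 _)).
  by move: B0; rewrite BT => /eqP; rewrite (negbTE cylinder_setT_neq0).
- apply: filterS ae_circle_regular => z /phase_flow[n hn].
  rewrite hn -circle_expD; congr circle_exp.
  rewrite -raddfD; apply/eq_proj_circle.
  rewrite (_ : _ - _ = (- n)%:~R) ?rpred_int// rmorphN/=.
  by rewrite [angle D b + _]addrC; ring.
Qed.

End one_sequence.

Lemma fract_half (x : R) : (fract (x + 2^-1) < 2^-1) = ~~ (fract x < 2^-1).
Proof.
have h := floor_itv x; rewrite rmorphD/= in h; move: h => /andP[h1 h2].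
have [fx|fx] := ltP (fract x) 2^-1.
  have -> : fract (x + 2^-1) = fract x + 2^-1.
    rewrite /fract (_ : Num.floor (x + 2^-1) = Num.floor x); first by ring.
    by apply: floor_def; rewrite rmorphD/=; move: fx; rewrite /fract => ?; apply/andP; split; lra.
  by have /andP[f0 f1] := fract_itv x; apply/negbTE; rewrite -leNgt; lra.
have -> : fract (x + 2^-1) = fract x - 2^-1.
  rewrite /fract (_ : Num.floor (x + 2^-1) = Num.floor x + 1); first by rewrite rmorphD/=; lra.
  by apply: floor_def; rewrite !rmorphD/=; move: fx; rewrite /fract => ?; apply/andP; split; lra.
have /andP[f0 f1] := fract_itv x.
by have -> : fract x - 2^-1 < 2^-1 by lra.
Qed.

(** If the angles differ by an integer, the difference v of the two phases is
    invariant modulo 1, and v(x, y + c) = v(x, y) + sg c with sg nonzero.  For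
    c = 1 / (2 sg) the vertical translation by c exchanges the invariant set
    {v} < 1/2 with its complement, so both have the same measure and, by
    ergodicity, both are null. *)
Lemma ergodic_angle_inj : ergodic mu flow ->
  injective (fun b => proj_circle (angle D b)).
Proof.
move=> erg b b' /eq_proj_circle/intrP[q hq]; apply: contrapT => bb'.
pose sg : R := digit_limit b - digit_limit b'.
have sg0 : sg != 0.
  by rewrite subr_eq0; apply/eqP => /digit_limit_inj.
pose v (z : circle R * mR) : R := phase b z - phase b' z.
have vE z (c : R) : v (z.1, z.2 + c) = v z + sg * c.
  by rewrite /v /phase /sg /=; ring.
pose A : set (circle R * mR) := [set z | fract (v z) < 2^-1].
have mA : measurable A.
  have mv : measurable_fun setT ((fun z => fract (1 * v z)) : circle R * mR -> mR).
    apply: (measurableT_comp (measurable_fract 1)).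
    by apply: measurable_funB; exact: measurable_phase.
  rewrite (_ : A = (fun z => fract (1 * v z)) @^-1` (`]-oo, 2^-1[%classic : set R)).
    by rewrite -[X in measurable X]setTI; apply: mv => //; exact: measurable_itv.
  by apply/seteqP; split => z; rewrite /A/= mul1r in_itv/=.
have inv : mu.-negligible ((flow @^-1` A) `+` A).
  have [B [mB B0 sub]] := ae_circle_regular; exists B; split => // z hz.
  apply: sub => /= rz; move: hz.
  have [n hn] := phase_flow b rz; have [n' hn'] := phase_flow b' rz.
  have AE : (flow @^-1` A) z <-> A z.
    rewrite /A/= /v hn hn'.
    rewrite (_ : _ - _ = phase b z - phase b' z + (q - n + n')%:~R).
      by rewrite fractDint// intr_int.
    by rewrite rmorphD rmorphB/= -hq; ring.
  by case=> -[h1 h2]; apply: h2; apply/AE.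
pose c := 2^-1 / sg.
have half : (fun z : circle R * mR => (z.1, z.2 + cst c z.1) : circle R * mR) @^-1` A = ~` A.
  apply/seteqP; split => z; rewrite /A/= vE /c mulrC divfK// fract_half => /negP//.
have mAA : mu (~` A) = mu A.
  by rewrite -half; apply: skew_measure_preserving => //; exact: measurable_cst.
have A0 : mu A = 0%E by case: (erg A mA inv) => //; rewrite mAA.
have /eqP := cylinder_setT_neq0; apply; apply/eqP; rewrite -measure_le0.
rewrite -(setvU A); apply: (le_trans (measureU2 _ (measurableC mA) mA)).
by rewrite [X in (X + _)%E]mAA [X in (X + _)%E]A0 [X in (_ + X)%E]A0 adde0.
Qed.

End spectrum.

Lemma uncountable_range T (f : (nat -> bool) -> T) (E : set T) :
  injective f -> (forall b, E (f b)) -> ~ countable E.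
Proof.
move=> finj fE /countable_injP[g ginj].
pose h b := g (f b).
have hinj : injective h by move=> b b' /ginj; rewrite !inE => /(_ (fE b) (fE b'))/finj.
(* The diagonal sequence of Cantor's argument. *)
pose d n := ~~ `[< exists2 b, h b = n & b n >].
have := erefl (d (h d)); rewrite {1}/d; case: asboolP => [[b /hinj -> ->]//|nb].
by move=> /esym dd; apply: nb; exists d.
Qed.

Theorem mainTheorem4 (R : realType) (alpha : R) :
  irrational alpha -> unbounded_partial_quotients alpha ->
  exists phi : circle R -> R,
    [/\ measurable_fun setT phi,
        ergodic (cylinder_measure R) (cylinder_flow alpha phi) &
        ~ countable (eigenvalues (cylinder_measure R) (cylinder_flow alpha phi))].
Proof.
move=> irr unb; have [D] := frequency_data_exists (@enum_rat R) irr unb.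
have erg : ergodic (cylinder_measure R) (cylinder_flow alpha (circle_cocycle D)).
  apply: rigid_ergodic.
  - exact: measurable_cocycle.
  - exact: cocycle_periodic.
  - move=> eps /(good_approximation irr unb)[q [p [q0 d0 qd]]].
    exists q, p; split => //; apply: le_lt_trans qd.
    by rewrite ler_peMl// ler1n.
  - move=> r N eps eps0; apply: cocycle_rigid => //; exact: enum_rat_often.
exists (circle_cocycle D); split => //; first exact: measurable_circle_cocycle.
by apply: (uncountable_range (ergodic_angle_inj erg)) => b; exact: angle_eigenvalue.
Qed.
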